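(* $\lambda_5(n)=O\big(n\alpha(n)2^{\alpha(n)}\big)$, and $\lambda_5(n,m)=m+O\big(n\alpha(n,m)2^{\alpha(n,m)}\big)$ for all $n,m\ge1$.
   Context: A sequence contains an alternation of length $7$ if there are distinct symbols $a\ne b$ and indices $i_1<\dots<i_7$ whose entries are $a,b,a,b,a,b,a$. $\lambda_5(n)$ is the maximum length of a sequence using at most $n$ distinct symbols with no two consecutive equal entries and no alternation of length $7$. A block is a sequence of pairwise distinct symbols; $\lambda_5(n,m)$ is the maximum length of a sequence using at most $n$ distinct symbols, with no alternation of length 7, that is a concatenation of at most $m$ blocks. Ackermann's function: $a_{1,j}=2^j$, $a_{i,1}=2$ ($i\ge2$), $a_{i,j}=w\cdot a_{i-1,w}$ with $w=a_{i,j-1}$ ($i,j\ge2$); $\alpha(n,m)=\min\{i: a_{i,j}\ge m,\ j=\max\{\lceil n/m\rceil,3\}\}$, $\alpha(n)=\alpha(n,n)$. *)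

(* Defs.v *)
From mathcomp Require Import all_boot.
Set Implicit Arguments. Unset Strict Implicit. Unset Printing Implicit Defensive.

Definition has_alt7 (s : seq nat) : Prop :=
  exists a b : nat, a != b /\ subseq [:: a; b; a; b; a; b; a] s.

Definition at_most_symbols (n : nat) (s : seq nat) : Prop :=
  size (undup s) <= n.

Definition no_adjacent_repeat (s : seq nat) : Prop :=
  forall i, i.+1 < size s -> nth 0 s i != nth 0 s i.+1.

Definition at_most_blocks (m : nat) (s : seq nat) : Prop :=
  exists bs : seq (seq nat), size bs <= m /\ all uniq bs /\ flatten bs = s.

Definition DS5 (n : nat) (s : seq nat) : Prop :=
  at_most_symbols n s /\ no_adjacent_repeat s /\ ~ has_alt7 s.

Definition DS5blocks (n m : nat) (s : seq nat) : Prop :=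
  at_most_symbols n s /\ ~ has_alt7 s /\ at_most_blocks m s.

(* Ackermann function a_{i,j} (meaningful for i, j >= 1; junk value 0 at
   index 0):
   a_{1,j} = 2^j, a_{i,1} = 2 (i >= 2), a_{i,j} = w * a_{i-1,w}, w = a_{i,j-1}. *)
Fixpoint ack (i j : nat) {struct i} : nat :=
  match i with
  | 0 => 0
  | i'.+1 =>
    match i' with
    | 0 => 2 ^ j
    | _ =>
      (fix g (j : nat) : nat :=
         match j with
         | 0 => 0
         | 1 => 2
         | j'.+1 => let w := g j' in w * ack i' w
         end) j
    end
  end.

Definition ceil_div (n m : nat) : nat := (n + m.-1) %/ m.

(* alpha(n,m) = min { i >= 1 : a_{i,j} >= m },  j = max(ceil(n/m), 3).
   Implemented as the first i in 1..m.+1 with a_{i,j} >= m; the minimum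
   always lies in this range since a_{i,j} >= a_{i,2} = 2^(i+1) > m for i = m. *)
Definition alpha2 (n m : nat) : nat :=
  let j := maxn (ceil_div n m) 3 in
  (find (fun i => m <= ack i.+1 j) (iota 0 m.+1)).+1.

Definition alpha (n : nat) : nat := alpha2 n n.

(* Main.v *)
Require Import Defs.
From mathcomp Require Import all_boot zify.
Set Implicit Arguments. Unset Strict Implicit. Unset Printing Implicit Defensive.

(** Cut a blocked sequence into intervals of [L] blocks; a symbol is local if it
    meets one interval and global otherwise, and contracting every interval to
    one block turns the global symbols into a shorter sequence of the same
    order.  Inside an interval, the symbols having their first or last
    occurrences there form a sequence of order 4, and the other global ones a
    sequence of order 3 only, which would lose a factor [alpha] at every level
    of the Ackermann recursion.  The gain comes from two markings [D] and [H] of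
    the occurrences, depending only on the intervals: if [abab] occurs in an
    interval [r] met by [a] and [b] before and after, then order 5 forces the
    nested pattern b..b a..a (abab) b..b a..a, and the markings are such that
    then [a] is [D]-marked or [b] is [H]-marked at [r].  Hence the unmarked
    occurrences expand with order 2, that is at most twice, while a symbol of an
    order 5 sequence carries only O(i^3) marks at level [i], each of which
    expands O(i) times.  This gives mu(i) = 2 mu(i-1) + O(2^i), i.e.
    mu(i) = O(i 2^i).

    For sequences without adjacent repeats the same argument is applied to
    O(n) greedily chosen intervals of order 3: each is a concatenation of
    linearly many blocks, so that its unmarked part has linear size. *)

(** * Alternations and blocked sequences *)

Fixpoint alt k (a b : nat) : seq nat :=
  if k is k'.+1 then a :: alt k' b a else [::].

(* Order [s] in the sense of Davenport and Schinzel is [altfree s.+2]. *)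
Definition altfree k (s : seq nat) : Prop :=
  forall a b, a != b -> ~~ subseq (alt k a b) s.

Lemma altfree_subseq k s t : subseq s t -> altfree k t -> altfree k s.
Proof.
by move=> st at_ a b /at_; apply: contra => /subseq_trans; apply.
Qed.

Lemma altS_rcons k a b : alt k.+1 a b = rcons (alt k a b) (if odd k then b else a).
Proof.
elim: k a b => // k IH a b.
by rewrite -[LHS]/(a :: alt k.+1 b a) IH /=; case: (odd k).
Qed.

Lemma mem_alt k a b : 1 < k -> (a \in alt k a b) * (b \in alt k a b).
Proof. by case: k => [|[|k]] //= _; rewrite !inE !eqxx orbT. Qed.

(** An alternation inside [v'] picks up one more letter from [u] and one more from [w], so each side
    on which all its symbols recur lowers the order by one. *)
Lemma altfree_middle (bef aft : bool) k u v w v' :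
  1 < k -> altfree (bef + k + aft) (u ++ v ++ w) -> subseq v' v ->
  (bef -> {subset v' <= u}) -> (aft -> {subset v' <= w}) -> altfree k v'.
Proof.
move=> k1 af sv hb ha a b ab; apply/negP => sab.
have [ain bin] := mem_alt a b k1.
have ain' := mem_subseq sab ain; have bin' := mem_subseq sab bin.
(* The letter that continues [alt k a b]. *)
pose e := if odd k then b else a.
have ein : e \in v' by rewrite /e; case: ifP.
have sub : subseq (nseq bef b ++ alt k a b ++ nseq aft e) (u ++ v ++ w).
  apply: cat_subseq.
    by case: bef hb {af} => /= hb; rewrite ?sub0seq // sub1seq; apply: hb.
  apply: cat_subseq; first exact: subseq_trans sab sv.
  by case: aft ha {af} => /= ha; rewrite ?sub0seq // sub1seq; apply: ha.
have E : alt k a b ++ nseq aft e = alt (k + aft) a b.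
  case: (aft); last by rewrite addn0 cats0.
  by rewrite addn1 altS_rcons cats1.
move: sub; rewrite E; case: (bef) af => /= af sub.
  by move/negP: (af b a (negbT (introF eqP (fun h => negP ab (introT eqP (esym h)))))); apply.
by move/negP: (af a b ab); apply.
Qed.

(* [(a, p)] stands for the symbol [a] in block [p]; the order of a list of
   occurrences is that of the sequence. *)
Notation occ := (nat * nat)%type.

(** Uniqueness of the pairs expresses that the symbols of a block are pairwise distinct. *)
Definition wf (S : seq occ) := uniq S /\ sorted leq (unzip2 S).
Definition below m (S : seq occ) := all (fun x : occ => x.2 < m) S.
Definition row (S : seq occ) a := [seq x.2 | x <- S & x.1 == a].
Definition nsym (S : seq occ) := size (undup (unzip1 S)).
Definition part L r (T : seq occ) : seq occ :=
  [seq (x.1, x.2 %% L) | x <- T & x.2 %/ L == r].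
Definition contract L (T : seq occ) : seq occ :=
  undup [seq (x.1, x.2 %/ L) | x <- T].

Lemma mem_row S a p : (p \in row S a) = ((a, p) \in S).
Proof.
apply/mapP/idP => [[[c q] /= + ->]|h]; last by exists (a, p); rewrite // mem_filter eqxx.
by rewrite mem_filter /= => /andP[/eqP ->].
Qed.

Lemma sorted_split2 (f : occ -> nat) c S : sorted leq (map f S) ->
  S = [seq x <- S | f x < c] ++ [seq x <- S | c <= f x].
Proof.
elim: S => //= x S IH so.
have {}IH := IH (path_sorted so).
case: ltnP => cx /=; first by rewrite -IH.
have hS : all (fun y => c <= f y) S.
  have := order_path_min leq_trans so.
  by rewrite all_map; apply: sub_all => y /= /(leq_trans cx).
have -> : [seq x <- S | f x < c] = [::].
  apply/eqP; rewrite -(negbK (_ == _)) -has_filter; apply/hasPn => y /(allP hS).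
  by rewrite leqNgt.
by rewrite (all_filterP hS).
Qed.

Lemma sorted_split3 L r (S : seq occ) : sorted leq (unzip2 S) ->
  S = [seq x <- S | x.2 %/ L < r] ++ [seq x <- S | x.2 %/ L == r]
      ++ [seq x <- S | r < x.2 %/ L].
Proof.
move=> so; have soL : sorted leq (map (fun x : occ => x.2 %/ L) S).
  rewrite (map_comp (fun p => p %/ L) (@snd nat nat)); apply: homo_sorted so => p q.
  exact: leq_div2r.
rewrite {1}(sorted_split2 r soL); congr (_ ++ _).
have soF : sorted leq (map (fun x : occ => x.2 %/ L) [seq x <- S | r <= x.2 %/ L]).
  by apply: (subseq_sorted leq_trans) soL; apply: map_subseq; apply: filter_subseq.
rewrite {1}(sorted_split2 r.+1 soF) -!filter_predI; congr (_ ++ _); apply: eq_filter => x /=; lia.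
Qed.

Lemma part_altfree (bef aft : bool) L r S T k :
  sorted leq (unzip2 S) -> subseq T S -> 1 < k ->
  altfree (bef + k + aft) (unzip1 S) ->
  (bef -> forall x, x \in T -> exists2 q, (x.1, q) \in S & q %/ L < x.2 %/ L) ->
  (aft -> forall x, x \in T -> exists2 q, (x.1, q) \in S & x.2 %/ L < q %/ L) ->
  altfree k (unzip1 (part L r T)).
Proof.
have E : unzip1 (part L r T) = unzip1 [seq x <- T | x.2 %/ L == r].
  by rewrite /unzip1 /part -map_comp.
rewrite E {E} => so sT k1; rewrite {1}(sorted_split3 L r so) /unzip1 !map_cat => af hb ha.
apply: (altfree_middle k1 af).
- apply: map_subseq.
  by rewrite subseq_filter filter_all (subseq_trans (filter_subseq _ _) sT).
- move=> /hb {}hb c /mapP [x + ->]; rewrite mem_filter => /andP[/eqP xr xT].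
  have [q qS lq] := hb x xT.
  by apply/mapP; exists (x.1, q); rewrite // mem_filter /= -xr lq qS.
move=> /ha {}ha c /mapP [x + ->]; rewrite mem_filter => /andP[/eqP xr xT].
have [q qS lq] := ha x xT.
by apply/mapP; exists (x.1, q); rewrite // mem_filter /= -xr lq qS.
Qed.

(** * Counting over intervals *)

Lemma sum_count_fibers (T : Type) (g : T -> nat) R (s : seq T) :
  all (fun x => g x < R) s -> \sum_(r < R) count (fun x => g x == r) s = size s.
Proof.
elim: s => [|x s IH] /=; first by rewrite big1.
move=> /andP[gx /IH {}IH]; rewrite big_split /= IH -add1n; congr (_ + _).
rewrite (bigD1 (Ordinal gx)) //= eqxx big1 // => i.
by rewrite -val_eqE /= eq_sym => /negbTE ->.
Qed.

Lemma size_inj_le (T U : eqType) (f : T -> U) (s : seq T) (t : seq U) :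
  uniq s -> {in s &, injective f} -> {in s, forall x, f x \in t} -> size s <= size t.
Proof.
move=> us fi fs; rewrite -(size_map f); apply: uniq_leq_size.
  by rewrite map_inj_in_uniq.
by move=> y /mapP [x xs ->]; apply: fs.
Qed.

Lemma wf_subseq S T : subseq S T -> wf T -> wf S.
Proof.
move=> st [uT sT]; split; first exact: subseq_uniq uT.
by apply: (subseq_sorted leq_trans) sT; apply: map_subseq.
Qed.

Lemma below_sub m S T : {subset S <= T} -> below m T -> below m S.
Proof. by move=> st /allP h; apply/allP => x /st /h. Qed.

Lemma unzip1_subseq (S T : seq occ) : subseq S T -> subseq (unzip1 S) (unzip1 T).
Proof. exact: map_subseq. Qed.

Lemma mem_part L r T a o :
  ((a, o) \in part L r T) -> exists2 p, (a, p) \in T & p %/ L = r /\ o = p %% L.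
Proof.
case/mapP => [[c p]]; rewrite mem_filter /= => /andP[/eqP pr pT] [-> ->].
by exists p.
Qed.

Lemma part_mem L T a p : (a, p) \in T -> (a, p %% L) \in part L (p %/ L) T.
Proof.
by move=> pT; apply/mapP; exists (a, p); rewrite // mem_filter /= eqxx.
Qed.

Lemma divn_modn_inj L p q : p %/ L = q %/ L -> p %% L = q %% L -> p = q.
Proof. by move=> d m; rewrite (divn_eq p L) (divn_eq q L) d m. Qed.

Lemma leq_modn_fiber L p q : p %/ L = q %/ L -> (p %% L <= q %% L) = (p <= q).
Proof.
by move=> d; rewrite {2}(divn_eq p L) {2}(divn_eq q L) d leq_add2l.
Qed.

Lemma ltn_modn_fiber L p q : p %/ L = q %/ L -> (p %% L < q %% L) = (p < q).
Proof. by move=> d; rewrite !ltnNge leq_modn_fiber. Qed.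

Lemma ltn_of_divn L p q : p %/ L < q %/ L -> p < q.
Proof. by rewrite !ltnNge; apply: contra; apply: leq_div2r. Qed.

Lemma wf_part L r T : wf T -> wf (part L r T).
Proof.
move=> [uT sT]; split.
  rewrite map_inj_in_uniq ?filter_uniq // => [[a p] [b q]].
  rewrite !mem_filter /= => /andP[/eqP dp _] /andP[/eqP dq _] [-> m].
  by congr (_, _); apply: (divn_modn_inj (L := L)); rewrite ?dp ?dq.
have -> : unzip2 (part L r T) = map (modn^~ L) [seq p <- unzip2 T | p %/ L == r].
  by rewrite /unzip2 /part -map_comp filter_map -map_comp.
have so := sorted_filter leq_trans (fun p => p %/ L == r) sT.
apply: (homo_sorted_in (P := fun p => p %/ L == r)) so; last exact: filter_all.
by move=> p q /eqP dp /eqP dq; rewrite leq_modn_fiber // dp dq.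
Qed.

Lemma below_part L r m T : 0 < L -> below m T -> below (minn L (m - r * L)) (part L r T).
Proof.
move=> L0 /allP bT; apply/allP => [[a o]] /mem_part [p /bT /= pm [pr ->]].
rewrite leq_min ltn_mod L0 /= -pr; have := divn_eq p L; lia.
Qed.

Lemma mem_contract L T a r :
  ((a, r) \in contract L T) -> exists2 p, (a, p) \in T & p %/ L = r.
Proof. by rewrite mem_undup => /mapP [[c p] pT [-> ->]]; exists p. Qed.

Lemma contract_mem L T a p : (a, p) \in T -> (a, p %/ L) \in contract L T.
Proof. by move=> pT; rewrite mem_undup; apply/mapP; exists (a, p). Qed.

Lemma wf_contract L T : sorted leq (unzip2 T) -> wf (contract L T).
Proof.
move=> sT; split; first exact: undup_uniq.
apply: (subseq_sorted leq_trans (map_subseq _ (undup_subseq _))).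
have -> : [seq i.2 | i <- [seq (x.1, x.2 %/ L) | x <- T]] = map (divn^~ L) (unzip2 T).
  by rewrite -!map_comp.
by apply: homo_sorted sT => p q; apply: leq_div2r.
Qed.

Lemma contract_unzip1 L T : subseq (unzip1 (contract L T)) (unzip1 T).
Proof.
have -> : unzip1 T = unzip1 [seq (x.1, x.2 %/ L) | x <- T].
  by rewrite /unzip1 -map_comp.
exact/map_subseq/undup_subseq.
Qed.

Lemma nsym_contract L T : nsym (contract L T) <= nsym T.
Proof.
apply: uniq_leq_size (undup_uniq _) _ => a; rewrite !mem_undup.
exact/mem_subseq/contract_unzip1.
Qed.

Lemma size_le_fst_inj (T : seq occ) (A : seq nat) : uniq T ->
  (forall a p q, (a, p) \in T -> (a, q) \in T -> p = q) ->
  {subset unzip1 T <= A} -> size T <= size (undup A).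
Proof.
move=> uT inj sA; apply: (size_inj_le (f := fst)) => // [[a p] [b q] pT qT /= e|x xT].
  by move: pT qT; rewrite e => pT qT; rewrite (inj _ _ _ pT qT).
by rewrite mem_undup; apply/sA/map_f.
Qed.

(** A symbol present in interval [r] corresponds to exactly one pair of the contraction. *)
Lemma sum_nsym_part L R T : \sum_(r < R) nsym (part L r T) <= size (contract L T).
Proof.
apply: (@leq_trans (\sum_(r < R) count (fun x : occ => x.2 == r) (contract L T))).
  apply: leq_sum => r _; rewrite -size_filter.
  apply: (size_inj_le (f := fun a => (a, r : nat))) => [|a b _ _ []//|a].
    exact: undup_uniq.
  rewrite mem_undup => /mapP [[c o] /mem_part [p pT [pr _]] -> /=].
  by rewrite mem_filter /= eqxx -pr contract_mem.
rewrite (eq_bigr (fun r : 'I_R => count (fun x : occ => x.2 == r)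
    [seq x <- contract L T | x.2 < R])) => [|r _].
  rewrite (@sum_count_fibers _ (fun x : occ => x.2)) ?filter_all // size_filter.
  exact: count_size.
rewrite count_filter; apply: eq_count => x /=.
by case: eqP => //= ->; rewrite ltn_ord.
Qed.

(** Intervals are charged for the blocks they really have, so the additive terms of a recursion add
    up without rounding loss. *)
Lemma sum_minn_interval L m R : \sum_(r < R) minn L (m - r * L) <= m.
Proof.
suff -> : \sum_(r < R) minn L (m - r * L) = minn (R * L) m by rewrite geq_minr.
elim: R => [|R IH]; first by rewrite big_ord0 mul0n min0n.
rewrite big_ord_recr /= IH mulSn; lia.
Qed.

Lemma part_sum (c : seq occ -> nat) mu ka L m R T : 0 < L -> below m T ->
  (forall r m', m' <= L -> below m' (part L r T) ->
     c (part L r T) <= mu * nsym (part L r T) + ka * m') ->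
  \sum_(r < R) c (part L r T) <= mu * size (contract L T) + ka * m.
Proof.
move=> L0 bT h.
apply: (@leq_trans (\sum_(r < R) (mu * nsym (part L r T) + ka * minn L (m - r * L)))).
  apply: leq_sum => r _; apply: h; first exact: geq_minl.
  exact: below_part.
rewrite big_split /= -!big_distrr /=; apply: leq_add; rewrite leq_mul2l.
  by rewrite sum_nsym_part orbT.
by rewrite sum_minn_interval orbT.
Qed.

Lemma below_fiber L m T : below m T -> all (fun x : occ => x.2 %/ L < m) T.
Proof.
move=> /allP bT; apply/allP => x /bT; apply: leq_ltn_trans; exact: leq_div.
Qed.

Lemma size_parts L m T : below m T -> size T = \sum_(r < m) size (part L r T).
Proof.
move=> bT; rewrite -(sum_count_fibers (below_fiber L bT)); apply: eq_bigr => r _.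
by rewrite size_map size_filter.
Qed.

(** A linear bound with fixed coefficients is claimed only up to [cap] blocks; the recursion trades
    larger coefficients for an Ackermann-type growth of [cap]. *)
Definition size_bound k cap mu ka := forall m S, m <= cap -> wf S -> below m S ->
  altfree k (unzip1 S) -> size S <= mu * nsym S + ka * m.

Lemma size_by_parts k L mu ka m T : 0 < L -> size_bound k L mu ka ->
  wf T -> below m T -> (forall r, altfree k (unzip1 (part L r T))) ->
  size T <= mu * size (contract L T) + ka * m.
Proof.
move=> L0 hb wT bT af; rewrite (size_parts L bT).
by apply: part_sum => // r m' m'L bm'; apply: hb => //; apply: wf_part.
Qed.

(** * Markings *)

(* A marking selects blocks in the row of a symbol, the list of the blocks where
   the symbol occurs. *)
Definition marking := seq nat -> nat -> bool.

Definition le_dir (d : bool) p q := if d then p <= q else q <= p.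

Definition fiber L r (X : seq nat) := [seq q %% L | q <- X & q %/ L == r].

Definition local_row L r (X : seq nat) := all (fun q => q %/ L == r) X.
Definition extreme d L r (X : seq nat) := all (fun q => le_dir d r (q %/ L)) X.
Definition tip d L p (X : seq nat) :=
  all (fun q => (q %/ L == p %/ L) ==> le_dir d q p) X.

(* Combines a marking [Dt] of the contracted rows with a marking [Ds] of the rows
   inside the intervals.  The direction [d = true] gives the [D]-markings (first
   interval, last occurrence in an interval), [d = false] their mirror images. *)
Definition compose_marking d L (Dt Ds : marking) : marking := fun X p =>
  let r := p %/ L in
  if local_row L r X then Ds (fiber L r X) (p %% L)
  else if extreme d L r X then tip d L p X || Ds (fiber L r X) (p %% L)
  else Dt [seq q %/ L | q <- X] r && tip d L p X.

(** The pattern b..b a..a before and after [p], for [X] the row of a and [Y] the row of b. Ties are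
    allowed, because the order inside one block of the contraction is lost. *)
Definition nested (X Y : seq nat) p : Prop :=
  [/\ p \in X /\ p \in Y,
      (exists2 x, x \in X & x < p) /\ (exists2 x, x \in X & p < x),
      (exists2 y, y \in Y & y < p) /\ (exists2 y, y \in Y & p < y) &
      forall x y, x \in X -> y \in Y ->
        (x < p -> y < p -> y <= x) /\ (p < x -> p < y -> y <= x)].

Definition covers_nested (D H : marking) :=
  forall X Y p, nested X Y p -> D X p || H Y p.

(** The same row arises as different lists, by contraction or by projection, so a marking may depend
    only on its set of blocks. *)
Definition extensional (D : marking) :=
  forall X Y p, X =i Y -> D X p = D Y p.

Lemma mem_fiber L r X o :
  (o \in fiber L r X) -> exists2 p, p \in X & p %/ L = r /\ o = p %% L.
Proof.
case/mapP => p; rewrite mem_filter => /andP[/eqP pr pX] ->.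
by exists p.
Qed.

Lemma fiber_mem L X r p : p \in X -> p %/ L = r -> p %% L \in fiber L r X.
Proof. by move=> pX <-; apply/mapP; exists p; rewrite // mem_filter eqxx. Qed.

Lemma compose_extensional d L Dt Ds :
  extensional Dt -> extensional Ds -> extensional (compose_marking d L Dt Ds).
Proof.
move=> et es X Y p XY; rewrite /compose_marking /local_row /extreme /tip !(eq_all_r XY).
have -> : Ds (fiber L (p %/ L) X) (p %% L) = Ds (fiber L (p %/ L) Y) (p %% L).
  by apply: es; apply: eq_mem_map => x; rewrite !mem_filter XY.
by congr (if _ then _ else if _ then _ else _ && _); apply: et; apply: eq_mem_map.
Qed.

Lemma nested_fiber L X Y p : nested X Y p ->
  (exists2 x, x \in X & x < p /\ x %/ L = p %/ L) ->
  (exists2 x, x \in X & p < x /\ x %/ L = p %/ L) ->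
  (exists2 y, y \in Y & y < p /\ y %/ L = p %/ L) ->
  (exists2 y, y \in Y & p < y /\ y %/ L = p %/ L) ->
  nested (fiber L (p %/ L) X) (fiber L (p %/ L) Y) (p %% L).
Proof.
case=> [[pX pY] _ _ ord] [x1 x1X [x1p x1r]] [x2 x2X [x2p x2r]]
  [y1 y1Y [y1p y1r]] [y2 y2Y [y2p y2r]].
split; first by split; apply: fiber_mem.
- by split; [exists (x1 %% L)|exists (x2 %% L)]; rewrite ?fiber_mem ?ltn_modn_fiber.
- by split; [exists (y1 %% L)|exists (y2 %% L)]; rewrite ?fiber_mem ?ltn_modn_fiber.
move=> _ _ /mem_fiber[x xX [xr ->]] /mem_fiber[y yY [yr ->]].
have [o1 o2] := ord x y xX yY.
by rewrite !ltn_modn_fiber ?leq_modn_fiber ?xr ?yr.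
Qed.

(* The case distinction follows the position of the interval of [p] among those
   met by [X] and by [Y]; nestedness forces [p] to be the right tip of [X] or
   the left tip of [Y] unless the whole pattern takes place inside the interval. *)
Lemma compose_covers L Dt Ht Ds Hs :
  covers_nested Dt Ht -> covers_nested Ds Hs ->
  covers_nested (compose_marking true L Dt Ds) (compose_marking false L Ht Hs).
Proof.
move=> ct cs X Y p nst; have [[pX pY] [[x1 x1X x1p] [x2 x2X x2p]]
  [[y1 y1Y y1p] [y2 y2Y y2p]] ord] := nst.
have mono (u v : nat) : u <= v -> u %/ L <= v %/ L by apply: leq_div2r.
have sub := @nested_fiber L X Y p nst.
have ordB x y (xX : x \in X) (yY : y \in Y) := (ord x y xX yY).1.
have ordA x y (xX : x \in X) (yY : y \in Y) := (ord x y xX yY).2.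
have y1x x : x \in X -> x < p -> y1 <= x by move=> xX xp; apply: ordB.
have x2y y : y \in Y -> p < y -> y <= x2 by move=> yY yp; apply: ordA.
(* Before [p], all of [Y] precedes all of [X], so an earlier occurrence of [Y] in the interval of
   [p] keeps [X] out of all previous intervals; [lastY] is the mirror image. *)
have firstX y : y \in Y -> y < p -> y %/ L = p %/ L -> extreme true L (p %/ L) X.
  move=> yY yp yr; apply/allP => x xX /=; rewrite -yr; apply: mono.
  by case: (ltnP x p) => xp; [apply: ordB|lia].
have lastY x : x \in X -> p < x -> x %/ L = p %/ L -> extreme false L (p %/ L) Y.
  move=> xX xp xr; apply/allP => y yY /=; rewrite -xr; apply: mono.
  by case: (ltnP p y) => yp; [apply: ordA|lia].
have tipX : ~~ tip true L p X -> exists2 x, x \in X & p < x /\ x %/ L = p %/ L.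
  case/allPn => x xX; rewrite negb_imply /= -ltnNge => /andP[/eqP xr xp].
  by exists x.
have tipY : ~~ tip false L p Y -> exists2 y, y \in Y & y < p /\ y %/ L = p %/ L.
  case/allPn => y yY; rewrite negb_imply /= -ltnNge => /andP[/eqP yr yp].
  by exists y.
have fX : extreme true L (p %/ L) X -> exists2 x, x \in X & x < p /\ x %/ L = p %/ L.
  move=> /allP /(_ x1 x1X) /= h; exists x1 => //; split=> //.
  by apply/eqP; rewrite eqn_leq h mono // ltnW.
have lY : extreme false L (p %/ L) Y -> exists2 y, y \in Y & p < y /\ y %/ L = p %/ L.
  move=> /allP /(_ y2 y2Y) /= h; exists y2 => //; split=> //.
  by apply/eqP; rewrite eqn_leq h mono // ltnW.
have loc Z z : local_row L (p %/ L) Z -> z \in Z -> z %/ L = p %/ L.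
  by move=> /allP h /h /eqP.
rewrite /compose_marking.
(* If [X] is local, its later occurrence makes this interval the last one of [Y]. Then [p] is the
   left tip of [Y], or the pattern lies inside the interval, where [Ds] and [Hs] decide. *)
case: ifP => [lX|nlX].
  have inX x := loc X x lX.
  have LY : extreme false L (p %/ L) Y by apply: (lastY x2) => //; apply: inX.
  have x1e : exists2 x, x \in X & x < p /\ x %/ L = p %/ L by exists x1; auto.
  have x2e : exists2 x, x \in X & p < x /\ x %/ L = p %/ L by exists x2; auto.
  case: ifP => [lY'|nlY].
    have y1e : exists2 y, y \in Y & y < p /\ y %/ L = p %/ L.
      by exists y1 => //; split=> //; apply: loc lY' _.
    exact: cs (sub x1e x2e y1e (lY LY)).
  rewrite LY; case: (boolP (tip false L p Y)) => [_|/tipY yb]; first by rewrite orbT.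
  exact: cs (sub x1e x2e yb (lY LY)).
case: (boolP (local_row L (p %/ L) Y)) => [lY'|nlY] /=.
  have inY y := loc Y y lY'.
  have FX : extreme true L (p %/ L) X by apply: (firstX y1) => //; apply: inY.
  have y1e : exists2 y, y \in Y & y < p /\ y %/ L = p %/ L by exists y1; auto.
  have y2e : exists2 y, y \in Y & p < y /\ y %/ L = p %/ L by exists y2; auto.
  rewrite FX; case: (boolP (tip true L p X)) => [//|/tipX xa].
  exact: cs (sub (fX FX) xa y1e y2e).
(* In the first interval of [X], either [p] is the right tip of [X], or a later occurrence of [X]
   there makes the interval the last one of [Y]. *)
case: ifP => [FX|nFX].
  case: (boolP (tip true L p X)) => [//|/tipX xa]; rewrite orFb.
  have LY : extreme false L (p %/ L) Y by case: xa => x xX [xp xr]; apply: lastY xr.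
  rewrite LY; case: (boolP (tip false L p Y)) => [_|/tipY yb]; first by rewrite orbT.
  exact: cs (sub (fX FX) xa yb (lY LY)).
(* Outside the first interval of [X], [p] must be the left tip of [Y]. Unless the interval is the
   last of [Y], [p] is also the right tip of [X], and nestedness passes to the contracted rows. *)
have tY : tip false L p Y.
  apply: contraFT nFX => /tipY [y yY [yp yr]]; exact: firstX yr.
rewrite tY; case: ifP => [LY|nLY]; first by rewrite orbT.
have tX : tip true L p X.
  apply: contraFT nLY => /tipX [x xX [xp xr]]; exact: lastY xr.
rewrite tX !andbT; apply: ct.
have [x3 x3X x3r] : exists2 x, x \in X & x %/ L < p %/ L.
  by move/negbT: nFX => /allPn[x xX]; rewrite -ltnNge; exists x.
have [y3 y3Y y3r] : exists2 y, y \in Y & p %/ L < y %/ L.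
  by move/negbT: nLY => /allPn[y yY]; rewrite -ltnNge; exists y.
have q_in (Z : seq nat) z : z \in Z -> z %/ L \in [seq q %/ L | q <- Z] by apply: map_f.
have x3p := ltn_of_divn x3r; have y3p := ltn_of_divn y3r.
split.
- by split; apply: q_in.
- split; first by exists (x3 %/ L); rewrite ?q_in.
  exists (x2 %/ L); first exact: q_in.
  apply: leq_trans y3r _; apply: mono; exact: x2y.
- split; last by exists (y3 %/ L); rewrite ?q_in.
  exists (y1 %/ L); first exact: q_in.
  apply: leq_ltn_trans x3r; apply: mono; exact: y1x.
move=> _ _ /mapP[x xX ->] /mapP[y yY ->]; have [o1 o2] := ord x y xX yY.
by split=> /ltn_of_divn xp /ltn_of_divn yp; apply: mono; auto.
Qed.

(** * Expanding the contracted sequence *)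

Lemma subseq2_total (s : seq nat) a b : a \in s -> b \in s -> a != b ->
  subseq [:: a; b] s || subseq [:: b; a] s.
Proof.
elim: s => // x s IH; rewrite !inE => + + ab.
case: (eqVneq a x) => [<-|ax]; case: (eqVneq b a) => [ba|ba] /=; rewrite ?eqxx.
- by rewrite ba eqxx in ab.
- by rewrite sub1seq eq_sym (negbTE ab) /= => _ ->.
- by rewrite ba eqxx in ab.
case: (eqVneq b x) => [<-|bx] /=; rewrite ?eqxx ?(negbTE ax).
  by rewrite sub1seq => -> _; rewrite orbT.
by move=> ha hb; apply: IH.
Qed.

Lemma size_cover (T : Type) (cs : seq (pred T)) (s : seq T) :
  all (fun x => has (fun c => c x) cs) s -> size s <= \sum_(c <- cs) size [seq x <- s | c x].
Proof.
elim: s => [|x s IH] /=; first by rewrite leq0n.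
move=> /andP[hx /IH {}IH].
rewrite (eq_bigr (fun c : pred T => c x + size [seq y <- s | c y])) => [|c _].
  rewrite big_split /= -add1n; apply: leq_add => //.
  elim: cs hx {IH} => //= c cs IHc; rewrite big_cons; case: (c x) => /= [_|/IHc]; lia.
by case: (c x).
Qed.

Definition first_in d L (S : seq occ) (x : occ) := extreme d L (x.2 %/ L) (row S x.1).

Lemma first_in_uniq d L S a p q : (a, p) \in S -> (a, q) \in S ->
  first_in d L S (a, p) -> first_in d L S (a, q) -> p %/ L = q %/ L.
Proof.
move=> pS qS /allP hp /allP hq.
have := hp q; have := hq p; rewrite !mem_row /le_dir /= => /(_ pS) + /(_ qS).
by case: d {hp hq} => h1 h2; apply/eqP; rewrite eqn_leq h1 h2.
Qed.

Lemma size_contract_first d L S :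
  size (contract L [seq x <- S | first_in d L S x]) <= nsym S.
Proof.
apply: size_le_fst_inj => [||a]; first exact: undup_uniq.
  move=> a p q /mem_contract[p' + <-] /mem_contract[q' + <-].
  rewrite !mem_filter => /andP[fp pS] /andP[fq qS].
  exact: first_in_uniq fq.
case/mapP => [[c r]] /mem_contract[p]; rewrite mem_filter => /andP[_ pS] _ ->.
exact: (map_f fst pS).
Qed.

Lemma not_first_before L S x : ~~ first_in true L S x ->
  exists2 q, (x.1, q) \in S & q %/ L < x.2 %/ L.
Proof. by case/allPn => q; rewrite mem_row /= -ltnNge; exists q. Qed.

Lemma not_first_after L S x : ~~ first_in false L S x ->
  exists2 q, (x.1, q) \in S & x.2 %/ L < q %/ L.
Proof. by case/allPn => q; rewrite mem_row /= -ltnNge; exists q. Qed.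

Definition all_global L S := forall x, x \in S -> ~~ local_row L (x.2 %/ L) (row S x.1).

(** A global symbol in its first interval recurs in a later one, and symmetrically for the last
    interval, so alternations extend on one side. *)
Lemma altfree_first d k L S r : sorted leq (unzip2 S) -> all_global L S -> 1 < k ->
  altfree k.+1 (unzip1 S) ->
  altfree k (unzip1 (part L r [seq x <- S | first_in d L S x])).
Proof.
move=> so gl k1 af.
have ex x : x \in S -> first_in d L S x ->
    exists2 q, (x.1, q) \in S & q %/ L != x.2 %/ L /\ le_dir d (x.2 %/ L) (q %/ L).
  move=> /gl /allPn [q qS qx] /allP /(_ q qS) h.
  by exists q; rewrite -?mem_row.
apply: (@part_altfree (~~ d) d L r S) => //.
- exact: filter_subseq.
- by case: d {ex}; rewrite ?add0n ?addn0 ?addn1 ?add1n.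
- case: d ex => //= ex _ x; rewrite mem_filter => /andP[fx /ex /(_ fx) [q qS []]].
  by rewrite /le_dir => ne le; exists q; rewrite // ltn_neqAle ne.
case: d ex => //= ex _ x; rewrite mem_filter => /andP[fx /ex /(_ fx) [q qS []]].
by rewrite /le_dir => ne le; exists q; rewrite // ltn_neqAle eq_sym ne.
Qed.

Lemma altfree_middle_class k L S r : sorted leq (unzip2 S) -> 1 < k ->
  altfree k.+2 (unzip1 S) ->
  altfree k (unzip1 (part L r
    [seq x <- S | ~~ first_in true L S x & ~~ first_in false L S x])).
Proof.
move=> so k1 af; apply: (@part_altfree true true L r S) => //.
- exact: filter_subseq.
- by rewrite add1n addn1.
- by move=> _ x; rewrite mem_filter => /andP[/andP[/not_first_before]].
by move=> _ x; rewrite mem_filter => /andP[/andP[_ /not_first_after]].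
Qed.

(** * Sequences of order at most 2 *)

Lemma size_bound2 cap : size_bound 2 cap 0 1.
Proof.
move=> m S _ [uS sS] bS af; rewrite mul0n mul1n add0n.
rewrite -(size_iota 0 m); apply: (size_inj_le (f := snd)) => // [[a p] [b q] pS qS /= e|x xS].
  rewrite e; congr (_, _); apply/eqP/negPn/negP => ab.
  have := subseq2_total (map_f fst pS) (map_f fst qS) ab.
  by rewrite (negbTE (af a b ab)) (negbTE (af b a _)) // eq_sym.
by rewrite mem_iota add0n; apply: (allP bS).
Qed.

Lemma size_first_le d S : uniq S -> size [seq x <- S | first_in d 1 S x] <= nsym S.
Proof.
move=> uS; apply: leq_trans (size_contract_first d 1 S).
apply: (size_inj_le (f := id)) => //; first exact: filter_uniq.
by move=> [a p] pS; rewrite -[p](divn1); apply: contract_mem.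
Qed.

(** Among the entries of one block that are not first occurrences, two distinct ones would extend to
    the left to an alternation of length 3, so each block has at most one. *)
Lemma size_bound3 cap : size_bound 3 cap 1 1.
Proof.
move=> m S _ [uS sS] bS af; rewrite !mul1n.
rewrite -(count_predC (first_in true 1 S)) -!size_filter; apply: leq_add.
  exact: size_first_le.
have w : wf [seq x <- S | predC (first_in true 1 S) x].
  by apply: (wf_subseq (filter_subseq _ _)).
rewrite -[m in X in _ <= X](mul1n m) -[X in _ <= X]add0n.
apply: leq_trans (size_by_parts _ (@size_bound2 1) w _ _) _ => //.
  exact: below_sub (mem_subseq (filter_subseq _ _)) bS.
move=> r; apply: (@part_altfree true false 1 r S) => //.
  exact: filter_subseq.
by move=> _ x; rewrite mem_filter => /andP[/not_first_before].
Qed.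

(** Besides first and last occurrences, each block has at most one entry, since two would extend on
    both sides. Blocks are treated as intervals of length 1. *)
Lemma size_bound4 cap : size_bound 4 cap 2 1.
Proof.
move=> m S _ [uS sS] bS af.
pose mid x := ~~ first_in true 1 S x && ~~ first_in false 1 S x.
have -> : 2 * nsym S + 1 * m = nsym S + (nsym S + (m + 0)) by lia.
apply: leq_trans (size_cover (cs := [:: first_in true 1 S; first_in false 1 S; mid]) _) _.
  by apply/allP => x _ /=; rewrite /mid; do 2!case: first_in.
rewrite !big_cons big_nil; do 2!(apply: leq_add; first exact: size_first_le).
rewrite leq_add2r.
have w : wf [seq x <- S | mid x] by apply: (wf_subseq (filter_subseq _ _)).
rewrite -[m in X in _ <= X](mul1n m) -[X in _ <= X]add0n.
apply: leq_trans (size_by_parts _ (@size_bound2 1) w _ _) _ => //.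
  exact: below_sub (mem_subseq (filter_subseq _ _)) bS.
by move=> r; apply: altfree_middle_class.
Qed.

Definition marks (D : marking) (S : seq occ) := [seq x <- S | D (row S x.1) x.2].

(** The mark sits in the contraction, so it selects all occurrences of the symbol in the interval at
    once. *)
Definition marked_in (D : marking) L (S : seq occ) (x : occ) :=
  D (row (contract L S) x.1) (x.2 %/ L).

Lemma size_contract_marked D L S :
  size (contract L [seq x <- S | marked_in D L S x]) <= size (marks D (contract L S)).
Proof.
apply: uniq_leq_size; first exact: undup_uniq.
move=> [a r] /mem_contract[p]; rewrite mem_filter => /andP[h pS] <-.
by rewrite mem_filter contract_mem // andbT.
Qed.

Lemma size_contract_le L (S T : seq occ) : {subset T <= S} -> size (contract L T) <= size (contract L S).
Proof.
move=> TS; apply: uniq_leq_size; first exact: undup_uniq.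
by move=> [a r] /mem_contract[p /TS pS <-]; apply: contract_mem.
Qed.

Lemma subseq2_of_lt L (S : seq occ) a b p q : sorted leq (unzip2 S) -> (a, p) \in S -> (b, q) \in S ->
  p %/ L < q %/ L -> subseq [:: a; b] (unzip1 S).
Proof.
move=> so pS qS lt; rewrite (sorted_split3 L (q %/ L) so) /unzip1 !map_cat.
rewrite -[[:: a; b]]/([:: a] ++ [:: b] ++ [::]) !cat_subseq ?sub0seq ?sub1seq //.
  by apply/mapP; exists (a, p); rewrite // mem_filter /= lt.
by apply/mapP; exists (b, q); rewrite // mem_filter /= eqxx.
Qed.

(** An [abab] inside the interval forces the rows of [a] and [b] to be nested there, since any other
    arrangement outside gives an alternation of length 7; nested rows carry a mark. *)
Lemma altfree_unmarked L S D H r : sorted leq (unzip2 S) -> covers_nested D H ->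
  altfree 7 (unzip1 S) ->
  altfree 4 (unzip1 (part L r [seq x <- S | [&& ~~ first_in true L S x,
    ~~ first_in false L S x, ~~ marked_in D L S x & ~~ marked_in H L S x]])).
Proof.
set T := [seq x <- S | _] => so cov af a b ab; apply/negP => sab.
have inT c : c \in alt 4 a b -> exists2 p, (c, p) \in T & p %/ L = r.
  move=> /(mem_subseq sab) /mapP [[c' o]] /mem_part[p pT [pr _]] ->.
  by exists p.
have [p pT pr] : exists2 p, (a, p) \in T & p %/ L = r by apply: inT; rewrite /= !inE eqxx.
have [q qT qr] : exists2 q, (b, q) \in T & q %/ L = r.
  by apply: inT; rewrite /= !inE eqxx orbT.
move: pT qT; rewrite !mem_filter.
move=> /andP[/and4P[/not_first_before[p1 p1S p1r] /not_first_after[p2 p2S p2r] Da _] pS].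
move=> /andP[/and4P[/not_first_before[q1 q1S q1r] /not_first_after[q2 q2S q2r] _ Hb] qS].
move: p1r p2r q1r q2r Da Hb; rewrite /marked_in /= pr qr => p1r p2r q1r q2r Da Hb.
pose U := [seq x <- S | x.2 %/ L < r]; pose W := [seq x <- S | r < x.2 %/ L].
have soF P : sorted leq (unzip2 [seq x <- S | P x]).
  by apply: (subseq_sorted leq_trans) so; apply/map_subseq/filter_subseq.
have glue u w : subseq u (unzip1 U) -> subseq w (unzip1 W) ->
    subseq (u ++ alt 4 a b ++ w) (unzip1 S).
  move=> su sw; rewrite (sorted_split3 L r so) /unzip1 !map_cat.
  apply: cat_subseq => //; apply: cat_subseq => //.
  apply: subseq_trans sab _; rewrite /unzip1 /part -map_comp /=.
  apply: map_subseq; rewrite subseq_filter filter_all.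
  exact: subseq_trans (filter_subseq _ _) (filter_subseq _ _).
have inU c o : (c, o) \in S -> o %/ L < r -> (c, o) \in U.
  by move=> oS h; rewrite mem_filter /= h.
have inW c o : (c, o) \in S -> r < o %/ L -> (c, o) \in W.
  by move=> oS h; rewrite mem_filter /= h.
have inX c o : (c, o) \in S -> o %/ L \in row (contract L S) c.
  by move=> oS; rewrite mem_row contract_mem.
suff nst : nested (row (contract L S) a) (row (contract L S) b) r.
  by have := cov _ _ _ nst; rewrite (negbTE Da) (negbTE Hb).
split.
- by split; [rewrite -pr|rewrite -qr]; apply: inX.
- by split; [exists (p1 %/ L)|exists (p2 %/ L)]; rewrite ?inX.
- by split; [exists (q1 %/ L)|exists (q2 %/ L)]; rewrite ?inX.
move=> x y; rewrite !mem_row => /mem_contract[p3 p3S <-] /mem_contract[q3 q3S <-].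
split=> h1 h2; rewrite leqNgt; apply/negP => lt.
  (* Here [ab] before, [abab] inside and [a] after form the forbidden alternation. *)
  have /glue : subseq [:: a; b] (unzip1 U).
    by apply: (subseq2_of_lt (soF _) _ _ lt); apply: inU.
  move=> /(_ [:: a]); rewrite sub1seq => /(_ (map_f fst (inW _ _ p2S p2r))).
  by move: (af a b ab) => /negP.
(* Here it is [b] before, [abab] inside and [ab] after. *)
have : subseq [:: a; b] (unzip1 W).
  by apply: (subseq2_of_lt (soF _) _ _ lt); apply: inW.
move/(glue [:: b]); rewrite sub1seq => /(_ (map_f fst (inU _ _ q1S q1r))).
by rewrite eq_sym in ab; move: (af b a ab) => /negP.
Qed.

(** * Local and global symbols *)

Definition all_local L S := forall x, x \in S -> local_row L (x.2 %/ L) (row S x.1).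

Lemma size_contract_local L S : all_local L S -> size (contract L S) <= nsym S.
Proof.
move=> lo; apply: size_le_fst_inj => [||a]; first exact: undup_uniq.
  move=> a p q /mem_contract[p' p'S <-] /mem_contract[q' q'S <-].
  by apply/eqP; apply: (allP (lo _ q'S)); rewrite mem_row.
case/mapP => [[c r]] /mem_contract[p pS _] ->; exact: (map_f fst pS).
Qed.

(** A global symbol meets two intervals, which forces [L < m]; rounding up the number of intervals
    then costs at most a factor 2. *)
Lemma global_intervals L capt m S : 0 < L -> below m S -> m <= L * capt ->
  all_global L S ->
  exists t, [/\ t <= capt, t * L <= 2 * m & below t (contract L S)].
Proof.
move=> L0 /allP bS mc gl; case: S bS gl => [_ _|[a p] S bS gl]; first by exists 0.
have [q qS qp] : exists2 q, (a, q) \in (a, p) :: S & q %/ L != p %/ L.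
  have /allPn [q] := gl (a, p) (mem_head _ _).
  by rewrite mem_row; exists q.
have Lm : L < m.
  rewrite ltnNge; apply: contra qp => mL.
  have qm := bS _ qS; have pm := bS _ (mem_head _ _).
  by rewrite !divn_small // (leq_trans _ mL).
exists (m.-1 %/ L).+1; split.
- by rewrite ltn_divLR // mulnC; lia.
- by rewrite mulSn; have := leq_trunc_div m.-1 L; lia.
apply/allP => [[c r]] /mem_contract[o /bS /= om <-].
by rewrite ltnS; apply: leq_div2r; lia.
Qed.

Definition local_part L (S : seq occ) :=
  [seq x <- S | local_row L (x.2 %/ L) (row S x.1)].
Definition global_part L (S : seq occ) :=
  [seq x <- S | ~~ local_row L (x.2 %/ L) (row S x.1)].

Lemma local_row_const L S a p q : (a, p) \in S -> (a, q) \in S ->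
  local_row L (p %/ L) (row S a) -> local_row L (q %/ L) (row S a).
Proof.
move=> pS qS lp; have := allP lp q.
by rewrite mem_row => /(_ qS) /= /eqP ->.
Qed.

Lemma row_local_part L S a p : (a, p) \in local_part L S ->
  row (local_part L S) a =i row S a.
Proof.
rewrite mem_filter => /andP[/= lp pS] q; rewrite !mem_row mem_filter /=.
by apply: andb_idl => qS; apply: local_row_const lp.
Qed.

Lemma row_global_part L S a p : (a, p) \in global_part L S ->
  row (global_part L S) a =i row S a.
Proof.
rewrite mem_filter => /andP[/= lp pS] q; rewrite !mem_row mem_filter /=.
by apply: andb_idl => qS; apply: contra lp => lq; apply: local_row_const lq.
Qed.

Lemma all_local_part L S : all_local L (local_part L S).
Proof.
move=> [a p] pS /=; rewrite /local_row (eq_all_r (row_local_part pS)).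
by move: pS; rewrite mem_filter => /andP[].
Qed.

Lemma all_global_part L S : all_global L (global_part L S).
Proof.
move=> [a p] pS /=; rewrite /local_row (eq_all_r (row_global_part pS)).
by move: pS; rewrite mem_filter => /andP[].
Qed.

Lemma nsym_local_global L S :
  nsym (local_part L S) + nsym (global_part L S) <= nsym S.
Proof.
rewrite /nsym -size_cat; apply: uniq_leq_size.
  rewrite cat_uniq !undup_uniq andbT /=; apply/hasPn => a.
  rewrite !mem_undup => /mapP[[c p] + ->]; rewrite mem_filter => /andP[/= lp pS].
  apply: contra lp => /mapP[[e q] + /= ce]; rewrite -ce mem_filter => /andP[/= lq qS].
  exact: local_row_const lq.
move=> a; rewrite mem_cat !mem_undup => /orP[] /mapP[x + ->];
  by rewrite mem_filter => /andP[_ xS]; apply: map_f.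
Qed.

Lemma size_local_global L S :
  size S = size (local_part L S) + size (global_part L S).
Proof. by rewrite !size_filter count_predC. Qed.

Lemma size_split_local k L capt mu ka m S : 0 < L -> size_bound k L mu ka ->
  m <= L * capt -> wf S -> below m S -> altfree k (unzip1 S) ->
  exists nl t, let G := global_part L S in
  [/\ nl + nsym G <= nsym S, size S <= mu * nl + ka * m + size G,
      t <= capt, t * L <= 2 * m & below t (contract L G)].
Proof.
move=> L0 hb mc wS bS af.
have sl : subseq (local_part L S) S by apply: filter_subseq.
have sg : subseq (global_part L S) S by apply: filter_subseq.
have bG := below_sub (mem_subseq sg) bS.
have [t [tc tL bt]] := global_intervals L0 bG mc (@all_global_part L S).
exists (nsym (local_part L S)), t; split=> //; first exact: nsym_local_global.
rewrite (size_local_global L) leq_add2r.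
apply: (@leq_trans (mu * size (contract L (local_part L S)) + ka * m)).
  apply: (size_by_parts L0 hb); first exact: wf_subseq sl wS.
    exact: below_sub (mem_subseq sl) bS.
  move=> r; apply: altfree_subseq af.
  have -> : unzip1 (part L r (local_part L S)) =
    unzip1 [seq x <- local_part L S | x.2 %/ L == r] by rewrite /unzip1 -map_comp.
  by apply/map_subseq/(subseq_trans (filter_subseq _ _)).
by rewrite leq_add2r leq_mul2l size_contract_local ?orbT //; apply: all_local_part.
Qed.

Lemma size_first_class d k L mu ka m G : 0 < L -> size_bound k L mu ka -> 1 < k ->
  wf G -> below m G -> all_global L G -> altfree k.+1 (unzip1 G) ->
  size [seq x <- G | first_in d L G x] <= mu * nsym G + ka * m.
Proof.
move=> L0 hb k1 wG bG gl af; have sf := filter_subseq (first_in d L G) G.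
apply: leq_trans (size_by_parts L0 hb (wf_subseq sf wG) (below_sub (mem_subseq sf) bG) _) _.
  by move=> r; apply: altfree_first => //; case: wG.
by rewrite leq_add2r leq_mul2l size_contract_first orbT.
Qed.

Lemma size_class k L mu ka m n (P : pred occ) (G : seq occ) :
  0 < L -> size_bound k L mu ka -> wf G -> below m G ->
  (forall r, altfree k (unzip1 (part L r [seq x <- G | P x]))) ->
  size (contract L [seq x <- G | P x]) <= n ->
  size [seq x <- G | P x] <= mu * n + ka * m.
Proof.
move=> L0 hb wG bG af sn; have sf := filter_subseq P G.
apply: leq_trans (size_by_parts L0 hb (wf_subseq sf wG) (below_sub (mem_subseq sf) bG) af) _.
by rewrite leq_add2r leq_mul2l sn orbT.
Qed.

Lemma size_contract_top k L t muh kah G : size_bound k t muh kah -> wf G ->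
  below t (contract L G) -> altfree k (unzip1 G) ->
  size (contract L G) <= muh * nsym G + kah * t.
Proof.
move=> ht wG bt aG; apply: leq_trans (ht _ _ (leqnn t) (wf_contract L _) bt _) _.
- by case: wG.
- exact: altfree_subseq (contract_unzip1 L G) aG.
by rewrite leq_add2r leq_mul2l nsym_contract orbT.
Qed.

Lemma size_bound_cap k c c' mu ka : c <= c' -> size_bound k c' mu ka -> size_bound k c mu ka.
Proof. by move=> cc h m S mc; apply: h; apply: leq_trans cc. Qed.

(* In the step lemmas, [nl] and [ng] count the local and the global symbols, and
   [t] the intervals met by global symbols; [t] may be [0], which is what makes
   [t * L <= 2 * m] possible for [m < L]. *)
Definition step_bound m L mu muh ka kah (S : seq occ) (c : nat) :=
  exists nl ng t, [/\ nl + ng <= nsym S, t * L <= 2 * m &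
    c <= mu * nl + muh * ng + ka * m + kah * t].

(** * Size recursions for orders 3, 4 and 5 *)

Lemma step_order3 L capt mu ka muh kah m S : 0 < L ->
  size_bound 5 L mu ka -> size_bound 5 capt muh kah ->
  m <= L * capt -> wf S -> below m S -> altfree 5 (unzip1 S) ->
  step_bound m L mu (4 + muh) (ka + 3) kah S (size S).
Proof.
move=> L0 hl ht mc wS bS af.
have [nl [t [nn sS tc tL bt]]] := size_split_local L0 hl mc wS bS af.
set G := global_part L S in nn sS bt; exists nl, (nsym G), t; split=> //.
have sg : subseq G S by apply: filter_subseq.
have wG := wf_subseq sg wS; have bG := below_sub (mem_subseq sg) bS.
have gG : all_global L G by apply: all_global_part.
have aG := altfree_subseq (unzip1_subseq sg) af.
have sC : size (contract L G) <= muh * nsym G + kah * t.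
  exact: size_contract_top (size_bound_cap tc ht) wG bt aG.
have f1 d := @size_first_class d 4 L 2 1 m G L0 (@size_bound4 L) isT wG bG gG aG.
pose mid x := ~~ first_in true L G x && ~~ first_in false L G x.
have f3 : size [seq x <- G | mid x] <= 1 * (muh * nsym G + kah * t) + 1 * m.
  apply: (size_class L0 (@size_bound3 L)) => // [r|].
    by apply: altfree_middle_class; case: wG.
  exact: leq_trans (size_contract_le _ (mem_subseq (filter_subseq _ _))) sC.
have := @size_cover _ [:: first_in true L G; first_in false L G; mid] G.
rewrite !big_cons big_nil => /(_ _) cov.
have {cov} : size G <= size [seq x <- G | first_in true L G x] +
  (size [seq x <- G | first_in false L G x] + (size [seq x <- G | mid x] + 0)).
  by apply: cov; apply/allP => x _ /=; rewrite /mid; do 2!case: first_in.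
have := f1 true; have := f1 false; nia.
Qed.

(** First and last intervals expand with order 3 and are charged to symbols; middle occurrences
    expand with order 2 and are charged twice to the contraction. *)
Lemma step_order4 L capt mu ka muh kah mu3 ka3 m S : 0 < L ->
  size_bound 6 L mu ka -> size_bound 6 capt muh kah -> size_bound 5 L mu3 ka3 ->
  m <= L * capt -> wf S -> below m S -> altfree 6 (unzip1 S) ->
  step_bound m L mu (2 * mu3 + 2 * muh) (ka + 2 * ka3 + 1) (2 * kah) S (size S).
Proof.
move=> L0 hl ht h3 mc wS bS af.
have [nl [t [nn sS tc tL bt]]] := size_split_local L0 hl mc wS bS af.
set G := global_part L S in nn sS bt; exists nl, (nsym G), t; split=> //.
have sg : subseq G S by apply: filter_subseq.
have wG := wf_subseq sg wS; have bG := below_sub (mem_subseq sg) bS.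
have gG : all_global L G by apply: all_global_part.
have aG := altfree_subseq (unzip1_subseq sg) af.
have sC : size (contract L G) <= muh * nsym G + kah * t.
  exact: size_contract_top (size_bound_cap tc ht) wG bt aG.
have f1 d := @size_first_class d 5 L mu3 ka3 m G L0 h3 isT wG bG gG aG.
pose mid x := ~~ first_in true L G x && ~~ first_in false L G x.
have f3 : size [seq x <- G | mid x] <= 2 * (muh * nsym G + kah * t) + 1 * m.
  apply: (size_class L0 (@size_bound4 L)) => // [r|].
    by apply: altfree_middle_class; case: wG.
  exact: leq_trans (size_contract_le _ (mem_subseq (filter_subseq _ _))) sC.
have := @size_cover _ [:: first_in true L G; first_in false L G; mid] G.
rewrite !big_cons big_nil => /(_ _) cov.
have {cov} : size G <= size [seq x <- G | first_in true L G x] +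
  (size [seq x <- G | first_in false L G x] + (size [seq x <- G | mid x] + 0)).
  by apply: cov; apply/allP => x _ /=; rewrite /mid; do 2!case: first_in.
have := f1 true; have := f1 false; nia.
Qed.

Lemma part_subseq L r (S T : seq occ) :
  subseq S T -> subseq (part L r S) (part L r T).
Proof.
move=> st; apply: map_subseq; rewrite subseq_filter filter_all.
exact: subseq_trans (filter_subseq _ _) st.
Qed.

Definition mark_bound (D : marking) k cap nu de := forall m S, m <= cap -> wf S ->
  below m S -> altfree k (unzip1 S) -> size (marks D S) <= nu * nsym S + de * m.

Lemma size_marks_top D k L t nuh deh G : mark_bound D k t nuh deh -> wf G ->
  below t (contract L G) -> altfree k (unzip1 G) ->
  size (marks D (contract L G)) <= nuh * nsym G + deh * t.
Proof.
move=> ht wG bt aG; apply: leq_trans (ht _ _ (leqnn t) (wf_contract L _) bt _) _.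
- by case: wG.
- exact: altfree_subseq (contract_unzip1 L G) aG.
by rewrite leq_add2r leq_mul2l nsym_contract orbT.
Qed.

Lemma mark_bound_cap D k c c' nu de :
  c <= c' -> mark_bound D k c' nu de -> mark_bound D k c nu de.
Proof. by move=> cc h m S mc; apply: h; apply: leq_trans cc. Qed.

(** Only the marked middle occurrences expand with order 3, so [mu3] multiplies the number of marks
    and not the size of the contraction; the unmarked ones expand with factor 2. *)
Lemma step_order5 D H L capt mu ka muh kah mu4 ka4 mu3 ka3 nuh deh m S : 0 < L ->
  covers_nested D H -> mark_bound D 7 capt nuh deh -> mark_bound H 7 capt nuh deh ->
  size_bound 7 L mu ka -> size_bound 7 capt muh kah ->
  size_bound 6 L mu4 ka4 -> size_bound 5 L mu3 ka3 ->
  m <= L * capt -> wf S -> below m S -> altfree 7 (unzip1 S) ->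
  step_bound m L mu (2 * mu4 + 2 * mu3 * nuh + 2 * muh) (ka + 2 * ka4 + 2 * ka3 + 1)
    (2 * mu3 * deh + 2 * kah) S (size S).
Proof.
move=> L0 cov hD hH hl ht h4 h3 mc wS bS af.
have [nl [t [nn sS tc tL bt]]] := size_split_local L0 hl mc wS bS af.
set G := global_part L S in nn sS bt; exists nl, (nsym G), t; split=> //.
have sg : subseq G S by apply: filter_subseq.
have wG := wf_subseq sg wS; have bG := below_sub (mem_subseq sg) bS.
have gG : all_global L G by apply: all_global_part.
have aG := altfree_subseq (unzip1_subseq sg) af.
have sC : size (contract L G) <= muh * nsym G + kah * t.
  exact: size_contract_top (size_bound_cap tc ht) wG bt aG.
have f1 d := @size_first_class d 6 L mu4 ka4 m G L0 h4 isT wG bG gG aG.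
have sM E : mark_bound E 7 capt nuh deh -> forall P : pred occ,
    (forall x, P x = ~~ first_in true L G x && ~~ first_in false L G x && marked_in E L G x) ->
    size [seq x <- G | P x] <= mu3 * (nuh * nsym G + deh * t) + ka3 * m.
  move=> hE P PE; apply: (size_class L0 h3) => // [r|].
    have := @altfree_middle_class 5 L G r _ isT aG; case: (wG) => _ sG /(_ sG).
    apply/altfree_subseq/map_subseq/part_subseq; rewrite subseq_filter filter_subseq.
    by rewrite andbT; apply/allP => x; rewrite mem_filter PE => /andP[/andP[->]].
  apply: leq_trans (size_marks_top (mark_bound_cap tc hE) wG bt aG).
  apply: leq_trans (size_contract_marked E L G); apply: size_contract_le => x.
  by rewrite !mem_filter PE => /andP[/andP[_ ->]].
pose mid x := ~~ first_in true L G x && ~~ first_in false L G x.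
pose mD x := mid x && marked_in D L G x; pose mH x := mid x && marked_in H L G x.
pose un x := [&& ~~ first_in true L G x, ~~ first_in false L G x,
  ~~ marked_in D L G x & ~~ marked_in H L G x].
have fD := sM D hD mD (fun x => erefl); have fH := sM H hH mH (fun x => erefl).
have fU : size [seq x <- G | un x] <= 2 * (muh * nsym G + kah * t) + 1 * m.
  apply: (size_class L0 (@size_bound4 L)) => // [r|].
    by apply: altfree_unmarked => //; case: wG.
  exact: leq_trans (size_contract_le _ (mem_subseq (filter_subseq _ _))) sC.
have := @size_cover _ [:: first_in true L G; first_in false L G; mD; mH; un] G.
rewrite !big_cons big_nil => /(_ _) cv.
have {cv} : size G <= size [seq x <- G | first_in true L G x] +
  (size [seq x <- G | first_in false L G x] + (size [seq x <- G | mD x] +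
   (size [seq x <- G | mH x] + (size [seq x <- G | un x] + 0)))).
  apply: cv; apply/allP => x _ /=; rewrite /mD /mH /un /mid.
  by do 2!case: first_in => //=; do 2!case: marked_in.
have := f1 true; have := f1 false; nia.
Qed.

(** * Recursion for the number of marks *)

Lemma size_fiber_marks Ds k L nu de m S T : 0 < L -> extensional Ds ->
  mark_bound Ds k L nu de -> wf T -> below m T ->
  (forall r, altfree k (unzip1 (part L r T))) -> subseq T S ->
  (forall a p q, (a, p) \in T -> (a, q) \in S -> q %/ L = p %/ L -> (a, q) \in T) ->
  size [seq x <- T | Ds (fiber L (x.2 %/ L) (row S x.1)) (x.2 %% L)] <=
  nu * size (contract L T) + de * m.
Proof.
move=> L0 es hb wT bT af st sat.
apply: (@leq_trans (\sum_(r < m) size (marks Ds (part L r T)))); last first.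
  apply: (part_sum (c := fun T => size (marks Ds T))) => // r m' m'L bm'; apply: hb => //; exact: wf_part.
rewrite -(sum_count_fibers (g := fun x : occ => x.2 %/ L) (R := m)); last first.
  by apply/allP => x; rewrite mem_filter => /andP[_]; apply: (allP (below_fiber L bT)).
apply: leq_sum => r _; rewrite -size_filter.
apply: (size_inj_le (f := fun x => (x.1, x.2 %% L))).
- by do 2!apply: filter_uniq; case: wT.
- move=> [a p] [b q]; rewrite !mem_filter /= => /andP[/eqP pr _] /andP[/eqP qr _] [-> e].
  by congr (_, _); apply: divn_modn_inj e; rewrite pr qr.
move=> [a p]; rewrite !mem_filter /= => /and3P[/eqP pr hD pT].
(* By saturation of [T] in [S], the row within the part and the fiber of the full row have the same
   elements, and [Ds] is extensional. *)
rewrite -pr part_mem // andbT; move: hD; rewrite (es _ (fiber L (p %/ L) (row S a))) //.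
move=> o; rewrite mem_row; apply/idP/idP.
  by case/mem_part => q qT [qr ->]; apply: fiber_mem; rewrite ?mem_row ?(mem_subseq st).
case/mem_fiber => q; rewrite mem_row => qS [qr ->]; rewrite -qr.
by apply: part_mem; apply: sat pT qS qr.
Qed.

Lemma size_marks_local_global D L S : extensional D ->
  size (marks D S) = size (marks D (local_part L S)) + size (marks D (global_part L S)).
Proof.
move=> eD; pose P (x : occ) := D (row S x.1) x.2.
have -> : marks D (local_part L S) = filter P (local_part L S).
  by apply: eq_in_filter => [[a p] xS]; apply: eD; apply: row_local_part xS.
have -> : marks D (global_part L S) = filter P (global_part L S).
  by apply: eq_in_filter => [[a p] xS]; apply: eD; apply: row_global_part xS.
rewrite -[marks D S]/(filter P S) /local_part /global_part.
rewrite -(count_predC (fun x : occ => local_row L (x.2 %/ L) (row S x.1)) (filter P S)).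
by rewrite !size_filter !count_filter; congr (_ + _); apply: eq_count => x /=; rewrite andbC.
Qed.

Lemma size_marks_local d Dt Ds k L nu de m S : 0 < L -> extensional Ds ->
  mark_bound Ds k L nu de -> wf S -> below m S -> altfree k (unzip1 S) -> all_local L S ->
  size (marks (compose_marking d L Dt Ds) S) <= nu * nsym S + de * m.
Proof.
move=> L0 es hb wS bS af lo; apply: (@leq_trans (nu * size (contract L S) + de * m)).
  have -> : marks (compose_marking d L Dt Ds) S =
      [seq x <- S | Ds (fiber L (x.2 %/ L) (row S x.1)) (x.2 %% L)].
    by apply: eq_in_filter => x xS; rewrite /compose_marking lo.
  apply: size_fiber_marks (hb) _ _ _ _ _ => // [r].
  apply: altfree_subseq af; rewrite /part /unzip1 -map_comp.
  exact/map_subseq/filter_subseq.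
by rewrite leq_add2r leq_mul2l size_contract_local ?orbT.
Qed.

Lemma size_tips_first d L S : uniq S ->
  size [seq x <- S | first_in d L S x && tip d L x.2 (row S x.1)] <= nsym S.
Proof.
move=> uS; apply: size_le_fst_inj => [||a]; first exact: filter_uniq.
  move=> a p q; rewrite !mem_filter /= => /andP[/andP[fp tp] pS] /andP[/andP[fq tq] qS].
  have e := first_in_uniq pS qS fp fq.
  have := allP tp q; have := allP tq p; rewrite !mem_row !e eqxx /le_dir /= => /(_ pS) + /(_ qS).
  by case: d {fp tp fq tq} => h1 h2; apply/eqP; rewrite eqn_leq h1 h2.
by case/mapP => [[c p]]; rewrite mem_filter => /andP[_ pS] ->; apply: (map_f fst pS).
Qed.

Lemma size_tips_marked d D L S : uniq S -> extensional D ->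
  size [seq x <- S | D [seq q %/ L | q <- row S x.1] (x.2 %/ L) && tip d L x.2 (row S x.1)]
  <= size (marks D (contract L S)).
Proof.
move=> uS eD; apply: (size_inj_le (f := fun x => (x.1, x.2 %/ L))); first exact: filter_uniq.
  move=> [a p] [b q]; rewrite !mem_filter /= => /andP[/andP[_ tp] pS] /andP[/andP[_ tq] qS].
  case=> ab e; move: tp pS; rewrite ab => tp pS; congr (_, _).
  have := allP tp q; have := allP tq p; rewrite !mem_row !e eqxx /le_dir /= => /(_ pS) + /(_ qS).
  by case: (d) => h1 h2; apply/eqP; rewrite eqn_leq h1 h2.
move=> [a p]; rewrite !mem_filter /= => /andP[/andP[h _] pS]; rewrite contract_mem // andbT.
rewrite (eD _ [seq q %/ L | q <- row S a]) // => r; rewrite mem_row.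
apply/idP/mapP => [/mem_contract[q qS <-]|[q]]; first by exists q; rewrite ?mem_row.
by rewrite mem_row => qS ->; apply: contract_mem.
Qed.

(** A mark of a global symbol is the tip of its extreme interval, one per symbol, or a [Ds]-mark in
    that interval, where the order is one lower, or the tip of an interval marked by [Dt], one per
    mark of the contraction. *)
Lemma step_marks d Dt Ds k L capt nu de nuh deh nu1 de1 m S : 0 < L -> 1 < k ->
  extensional Dt -> extensional Ds ->
  mark_bound Ds k.+1 L nu de -> mark_bound Ds k L nu1 de1 ->
  mark_bound Dt k.+1 capt nuh deh ->
  m <= L * capt -> wf S -> below m S -> altfree k.+1 (unzip1 S) ->
  step_bound m L nu (1 + nu1 + nuh) (de + de1) deh S
    (size (marks (compose_marking d L Dt Ds) S)).
Proof.
move=> L0 k1 et es hl h1 ht mc wS bS af.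
have sl : subseq (local_part L S) S by apply: filter_subseq.
have sg : subseq (global_part L S) S by apply: filter_subseq.
have bG := below_sub (mem_subseq sg) bS; have wG := wf_subseq sg wS.
have aG := altfree_subseq (unzip1_subseq sg) af.
have gG := @all_global_part L S.
have [t [tc tL bt]] := global_intervals L0 bG mc gG.
exists (nsym (local_part L S)), (nsym (global_part L S)), t.
split=> //; first exact: nsym_local_global.
rewrite (@size_marks_local_global _ L) //; last exact: compose_extensional.
have lM : size (marks (compose_marking d L Dt Ds) (local_part L S)) <=
    nu * nsym (local_part L S) + de * m.
  have [wl loc] := (wf_subseq sl wS, @all_local_part L S).
  apply: (@size_marks_local d Dt Ds _ _ _ _ _ _ L0 es hl wl) => //.
    exact: below_sub (mem_subseq sl) bS.
  exact: altfree_subseq (unzip1_subseq sl) af.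
move: (global_part L S) bG wG aG gG bt {sg} => G bG wG aG gG bt.
pose c1 x := first_in d L G x && tip d L x.2 (row G x.1).
pose c2 x := first_in d L G x && Ds (fiber L (x.2 %/ L) (row G x.1)) (x.2 %% L).
pose c3 (x : occ) := Dt [seq q %/ L | q <- row G x.1] (x.2 %/ L) && tip d L x.2 (row G x.1).
have uG : uniq G by case: wG.
have f1 : size [seq x <- G | c1 x] <= nsym G by apply: size_tips_first.
have f3 : size [seq x <- G | c3 x] <= nuh * nsym G + deh * t.
  apply: leq_trans (size_tips_marked d L uG et) _.
  exact: size_marks_top (mark_bound_cap tc ht) wG bt aG.
have f2 : size [seq x <- G | c2 x] <= nu1 * nsym G + de1 * m.
  pose F := [seq x <- G | first_in d L G x].
  have sF : subseq F G by apply: filter_subseq.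
  have -> : [seq x <- G | c2 x] =
      [seq x <- F | Ds (fiber L (x.2 %/ L) (row G x.1)) (x.2 %% L)].
    by rewrite /F -filter_predI; apply: eq_filter => x; rewrite /= andbC.
  apply: leq_trans (size_fiber_marks L0 es h1 (wf_subseq sF wG) _ _ sF _) _.
  - exact: below_sub (mem_subseq sF) bG.
  - by move=> r; apply: altfree_first => //; case: wG.
  - move=> a p q; rewrite !mem_filter /first_in /= => /andP[fp pS] qS ->.
    by rewrite fp.
  by rewrite leq_add2r leq_mul2l size_contract_first orbT.
have gM : size (marks (compose_marking d L Dt Ds) G) <=
    size [seq x <- G | c1 x] + (size [seq x <- G | c2 x] + (size [seq x <- G | c3 x] + 0)).
  have := @size_cover _ [:: c1; c2; c3] (marks (compose_marking d L Dt Ds) G).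
  rewrite !big_cons big_nil => h; apply: leq_trans (h _) _.
    apply/allP => x; rewrite mem_filter => /andP[+ xG].
    rewrite /= /c1 /c2 /c3 /compose_marking (negbTE (gG x xG)) /first_in.
    by case: extreme => [/orP[]|] -> /=; rewrite ?orbT.
  have sub c : size [seq x <- marks (compose_marking d L Dt Ds) G | c x] <=
      size [seq x <- G | c x].
    by rewrite !size_filter count_filter; apply: sub_count => x /andP[].
  by rewrite !leq_add.
nia.
Qed.

(** * The Ackermann recursion *)

(* At level [i.+1] the intervals have [w ^ 3] blocks with [w = ack i.+1 j], which
   absorbs the cubic dependence on [w] of the level [i] bounds. *)
Definition cap i j := if i is 0 then 8 else ack i j ^ 3.

(** The digit is the order; [mu] is for sizes and [nu] for marks, and the recursions are those of
    the step lemmas. The start value 8 is the number of blocks in the base case. *)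
Definition mu3 i := 4 * i + 8.
Fixpoint mu4 i := if i is i'.+1 then 2 * mu3 i + 2 * mu4 i' else 8.
Fixpoint nu4 i := if i is i'.+1 then 1 + mu3 i + nu4 i' else 8.
Fixpoint nu5 i := if i is i'.+1 then 1 + nu4 i + nu5 i' else 8.
Fixpoint mu5 i :=
  if i is i'.+1 then 2 * mu4 i + 2 * mu3 i * nu5 i' + 2 * mu5 i' else 8.

Lemma coef_ge8 i :
  [/\ 8 <= mu3 i, 8 <= mu4 i, 8 <= mu5 i, 8 <= nu4 i & 8 <= nu5 i].
Proof.
have m3 k : 8 <= mu3 k by rewrite leq_addl.
have m4 k : 8 <= mu4 k by elim: k => // k IH /=; have := m3 k.+1; lia.
have n4 k : 8 <= nu4 k by elim: k => // k IH /=; lia.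
have n5 k : 8 <= nu5 k by elim: k => // k IH /=; lia.
by split=> //; elim: i => // i IH /=; lia.
Qed.

(** Passing from [j] to the next index adds a constant to the additive coefficient at order 3, and
    at each higher order the coefficient of the order below; hence the powers of [j]. *)
Definition level_bounds i j (D H : marking) :=
  [/\ [/\ extensional D, extensional H & covers_nested D H],
      mark_bound D 6 (cap i j) (nu4 i) (nu4 i * j ^ 2) /\
      mark_bound H 6 (cap i j) (nu4 i) (nu4 i * j ^ 2),
      mark_bound D 7 (cap i j) (nu5 i) (nu5 i * j ^ 3) /\
      mark_bound H 7 (cap i j) (nu5 i) (nu5 i * j ^ 3) &
      [/\ size_bound 5 (cap i j) (mu3 i) (mu3 i * j),
          size_bound 6 (cap i j) (mu4 i) (mu4 i * j ^ 2) &
          size_bound 7 (cap i j) (mu5 i) (mu5 i * j ^ 3)]].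

Lemma size_le_blocks m S : wf S -> below m S -> size S <= m * nsym S.
Proof.
move=> [uS _] /allP bS.
have -> : m * nsym S = size [seq (p, a) | p <- iota 0 m, a <- undup (unzip1 S)].
  by rewrite size_allpairs size_iota.
apply: (size_inj_le (f := fun x => (x.2, x.1))) => // [[a p] [b q] _ _ [-> ->] //|[a p] pS].
apply/allpairsP; exists (p, a); rewrite mem_iota add0n /= mem_undup.
by split=> //; [exact: (bS _ pS)|exact: (map_f fst pS)].
Qed.

(** With at most 8 blocks every symbol occurs at most 8 times, so everything may be marked. *)
Lemma level_bounds_base i j : cap i j = 8 ->
  level_bounds i j (fun _ _ => true) (fun _ _ => true).
Proof.
move=> c8; have [m3 m4 m5 n4 n5] := coef_ge8 i.
have triv k mu ka : 8 <= mu -> size_bound k (cap i j) mu ka.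
  move=> h m S; rewrite c8 => m8 wS bS _; apply: leq_trans (size_le_blocks wS bS) _.
  by apply: leq_trans (leq_addr _ _); rewrite leq_mul2r (leq_trans m8 h) orbT.
have mtriv k mu ka : 8 <= mu -> mark_bound (fun _ _ => true) k (cap i j) mu ka.
  move=> h m S mc wS bS af; rewrite /marks filter_predT; exact: (triv k mu ka h).
by split; [split|split; apply: mtriv|split; apply: mtriv|split; apply: triv].
Qed.

Lemma ack_succ i j : ack i.+2 j.+2 = ack i.+2 j.+1 * ack i.+1 (ack i.+2 j.+1).
Proof. by []. Qed.

(** Room for [cap i w] intervals of [w ^ 3] blocks. The value 8 at level 0 makes this fit powers of
    2 at level 1, where doubling [w] multiplies its cube by 8. *)
Lemma cap_succ i j : cap i.+1 j.+2 = ack i.+1 j.+1 ^ 3 * cap i (ack i.+1 j.+1).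
Proof.
case: i => [|i]; last by rewrite /cap ack_succ expnMn.
by rewrite /cap /= [2 ^ j.+2]expnS expnMn mulnC.
Qed.

Lemma step_bound_le m L mu muh ka kah KA S c :
  step_bound m L mu muh ka kah S c -> muh <= mu ->
  (forall t, t * L <= 2 * m -> ka * m + kah * t <= KA * m) ->
  c <= mu * nsym S + KA * m.
Proof.
move=> [nl [ng [t [nn tL cb]]]] hm /(_ t tL) hk.
have := leq_mul2r ng muh mu; rewrite hm orbT => h.
have := leq_mul2l mu (nl + ng) (nsym S); rewrite nn orbT mulnDr => h'.
lia.
Qed.

Lemma level_bounds_step i j D H D' H' : let w := ack i.+1 j.+1 in 1 < w ->
  level_bounds i w D H -> level_bounds i.+1 j.+1 D' H' ->
  level_bounds i.+1 j.+2 (compose_marking true (w ^ 3) D D')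
    (compose_marking false (w ^ 3) H H').
Proof.
move=> w w1 [[eD eH cDH] [D6 H6] [D7 H7] [S5 S6 S7]].
move=> [[eD' eH' cDH'] [D6' H6'] [D7' H7'] [S5' S6' S7']].
have L0 : 0 < w ^ 3 by rewrite expn_gt0 (ltnW w1).
have capL : cap i.+1 j.+1 = w ^ 3 by [].
have capS := cap_succ i j; rewrite -/w in capS.
rewrite capL in D6' H6' D7' H7' S5' S6' S7'.
have [m3 m4 m5 n4 n5] := coef_ge8 i; have [m3' m4' _ n4' _] := coef_ge8 i.+1.
(* The additive coefficients of level [i] are taken at index [w]; a bound of [2 * m] on [t * w ^ 3]
   turns their powers of [w] into constants. *)
have wt3 m t : t * w ^ 3 <= 2 * m -> w ^ 3 * t <= 2 * m by rewrite mulnC.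
have wt2 m t : t * w ^ 3 <= 2 * m -> w ^ 2 * t <= m.
  by rewrite -(leq_pmul2l (isT : 0 < 2)) !expnS expn0; nia.
have wt1 m t : t * w ^ 3 <= 2 * m -> w * t <= m.
  by move=> /wt2; rewrite !expnS expn0; nia.
(* At order 3 the crude bound of marks by all occurrences suffices. *)
have triv E : mark_bound E 5 (w ^ 3) (mu3 i.+1) (mu3 i.+1 * j.+1).
  move=> m S mc wS bS af; apply: leq_trans (S5' m S mc wS bS af).
  by rewrite size_filter count_size.
have hk4 m t : t * w ^ 3 <= 2 * m ->
    (nu4 i.+1 * j.+1 ^ 2 + mu3 i.+1 * j.+1) * m + nu4 i * w ^ 2 * t <= nu4 i.+1 * j.+2 ^ 2 * m.
  move=> /wt2 h; rewrite -mulnA.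
  apply: (@leq_trans ((nu4 i.+1 * j.+1 ^ 2 + mu3 i.+1 * j.+1 + nu4 i) * m)).
    by rewrite [X in _ <= X]mulnDl leq_add2l leq_mul2l h orbT.
  rewrite leq_mul2r; apply/orP; right; rewrite /= !expnS !expn0.
  move: (mu3 i.+1) (nu4 i) n4 m3' => a b; nia.
have hk5 m t : t * w ^ 3 <= 2 * m ->
    (nu5 i.+1 * j.+1 ^ 3 + nu4 i.+1 * j.+1 ^ 2) * m + nu5 i * w ^ 3 * t
      <= nu5 i.+1 * j.+2 ^ 3 * m.
  move=> /wt3 h; rewrite -mulnA.
  apply: (@leq_trans ((nu5 i.+1 * j.+1 ^ 3 + nu4 i.+1 * j.+1 ^ 2 + nu5 i * 2) * m)).
    by rewrite [X in _ <= X]mulnDl leq_add2l -mulnA leq_mul2l h orbT.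
  rewrite leq_mul2r; apply/orP; right.
  have -> : nu5 i.+1 = 1 + nu4 i.+1 + nu5 i by [].
  rewrite !expnS !expn0; move: (nu4 i.+1) (nu5 i) n5 n4' => a b; nia.
have step4 d Dt Ds : extensional Dt -> extensional Ds ->
    mark_bound Dt 6 (cap i w) (nu4 i) (nu4 i * w ^ 2) ->
    mark_bound Ds 6 (w ^ 3) (nu4 i.+1) (nu4 i.+1 * j.+1 ^ 2) ->
    mark_bound (compose_marking d (w ^ 3) Dt Ds) 6 (cap i.+1 j.+2) (nu4 i.+1)
      (nu4 i.+1 * j.+2 ^ 2).
  move=> et es ht hs m S; rewrite capS => mc wS bS af.
  apply: step_bound_le (hk4 m); last exact: leqnn.
  exact: (step_marks d L0 _ et es hs (triv Ds) ht mc wS bS af).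
have step5 d Dt Ds : extensional Dt -> extensional Ds ->
    mark_bound Dt 7 (cap i w) (nu5 i) (nu5 i * w ^ 3) ->
    mark_bound Ds 7 (w ^ 3) (nu5 i.+1) (nu5 i.+1 * j.+1 ^ 3) ->
    mark_bound Ds 6 (w ^ 3) (nu4 i.+1) (nu4 i.+1 * j.+1 ^ 2) ->
    mark_bound (compose_marking d (w ^ 3) Dt Ds) 7 (cap i.+1 j.+2) (nu5 i.+1)
      (nu5 i.+1 * j.+2 ^ 3).
  move=> et es ht hs h1 m S; rewrite capS => mc wS bS af.
  apply: step_bound_le (hk5 m); last exact: leqnn.
  exact: (step_marks d L0 _ et es hs h1 ht mc wS bS af).
split.
- by split; [exact: compose_extensional|exact: compose_extensional|exact: compose_covers].
- by split; apply: step4.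
- by split; apply: step5.
split=> m S; rewrite capS => mc wS bS af.
- apply: step_bound_le (step_order3 L0 S5' S5 mc wS bS af) _ _; first by rewrite /mu3; lia.
  move=> t /wt1 h; rewrite -mulnA.
  apply: (@leq_trans ((mu3 i.+1 * j.+1 + 3 + mu3 i) * m)).
    by rewrite [X in _ <= X]mulnDl leq_add2l leq_mul2l h orbT.
  by rewrite leq_mul2r /mu3; apply/orP; right; nia.
- apply: step_bound_le (step_order4 L0 S6' S6 S5' mc wS bS af) _ _; first exact: leqnn.
  move=> t /wt2 h; rewrite -mulnA -mulnA.
  apply: (@leq_trans ((mu4 i.+1 * j.+1 ^ 2 + 2 * (mu3 i.+1 * j.+1) + 1 + 2 * mu4 i) * m)).
    by rewrite [X in _ <= X]mulnDl leq_add2l -mulnA leq_mul2l leq_mul2l h orbT.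
  rewrite leq_mul2r; apply/orP; right.
  have -> : mu4 i.+1 = 2 * mu3 i.+1 + 2 * mu4 i by [].
  rewrite !expnS !expn0; move: (mu3 i.+1) (mu4 i) m4 m3' => a b; nia.
apply: step_bound_le (step_order5 L0 cDH D7 H7 S7' S7 S6' S5' mc wS bS af) _ _.
  exact: leqnn.
move=> t /wt3 h.
have -> : (2 * mu3 i.+1 * (nu5 i * w ^ 3) + 2 * (mu5 i * w ^ 3)) * t =
  (2 * (mu3 i.+1 * nu5 i) + 2 * mu5 i) * (w ^ 3 * t) by nia.
apply: (@leq_trans ((mu5 i.+1 * j.+1 ^ 3 + 2 * (mu4 i.+1 * j.+1 ^ 2) +
    2 * (mu3 i.+1 * j.+1) + 1 + (2 * (mu3 i.+1 * nu5 i) + 2 * mu5 i) * 2) * m)).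
  by rewrite [X in _ <= X]mulnDl leq_add2l -mulnA leq_mul2l h orbT.
rewrite leq_mul2r; apply/orP; right.
have -> : mu5 i.+1 = 2 * mu4 i.+1 + 2 * (mu3 i.+1 * nu5 i) + 2 * mu5 i by rewrite mulnA.
have le : mu3 i.+1 <= mu3 i.+1 * nu5 i by rewrite leq_pmulr // (leq_trans _ n5).
rewrite !expnS !expn0; move: le m4' m5; move: (mu3 i.+1) (mu3 i.+1 * nu5 i) (mu4 i.+1) (mu5 i).
move=> d b a c le a8 c8.
have : d * j.+1 <= b * j.+1 by rewrite leq_mul2r le orbT.
nia.
Qed.

(** * Growth of the Ackermann function and its inverse *)

Lemma ack_at1 i : ack i.+1 1 = 2.
Proof. by case: i. Qed.

Lemma ack_ge_exp2 i j : 0 < j -> 2 ^ j <= ack i.+1 j.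
Proof.
elim: i j => [//|i IHi] [//|j] _; elim: j => [|j IHj]; first by rewrite ack_at1.
rewrite ack_succ expnSr; apply: leq_mul => //.
have w0 : 0 < ack i.+2 j.+1 by apply: leq_trans IHj; rewrite expn_gt0.
apply: leq_trans (IHi _ w0); rewrite -[X in X <= _]expn1 leq_exp2l //.
Qed.

Lemma ack_gt1 i j : 1 < ack i.+1 j.+1.
Proof.
apply: leq_trans (ack_ge_exp2 i (ltn0Sn j)).
by rewrite -[X in X <= _]expn1 leq_exp2l.
Qed.

Lemma ack_monotone i j j' : j <= j' -> ack i.+1 j <= ack i.+1 j'.
Proof.
move: j j'; apply: (homo_leq leqnn leq_trans) => -[|j]; first by case: i => [|i]; rewrite // ltnW // ack_gt1.
case: i => [|i]; first by rewrite /= leq_exp2l.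
rewrite ack_succ leq_pmulr // -(prednK (ltnW (ack_gt1 i.+1 j))); exact: ltnW (ack_gt1 _ _).
Qed.

(** Guarantees that the search defining [alpha2] succeeds in its finite range. *)
Lemma ack_ge_level i j : 1 < j -> i < ack i.+1 j.
Proof.
move=> j1; apply: leq_trans (ack_monotone i j1).
elim: i => [//|i IH]; rewrite ack_succ ack_at1.
by move: (ack i.+1 2) IH => a; lia.
Qed.

Lemma alpha2_spec n m : exists2 i, alpha2 n m = i.+1 &
  m <= ack i.+1 (maxn (ceil_div n m) 3) /\
  forall k, m <= ack k.+1 (maxn (ceil_div n m) 3) -> k <= m -> i <= k.
Proof.
rewrite /alpha2; set j := maxn _ 3; set P := fun i => m <= ack i.+1 j.
have hP : has P (iota 0 m.+1).
  apply/hasP; exists m; first by rewrite mem_iota add0n leqnn.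
  by apply/ltnW/ack_ge_level; rewrite leq_max orbT.
exists (find P (iota 0 m.+1)) => //; split.
  have := nth_find 0 hP; rewrite nth_iota //.
  by rewrite has_find size_iota in hP.
move=> k Pk km; rewrite leqNgt; apply/negP => lt.
by have := before_find 0 lt; rewrite nth_iota // add0n /P Pk.
Qed.

(** Double induction following the definition of [ack]: the contracted sequence uses level [i] at
    index [ack i.+1 j.+1], the intervals use level [i.+1] at the previous index. *)
Lemma level_bounds_exist i j : exists D H, level_bounds i j.+1 D H.
Proof.
elim: i j => [|i IHi] j; first by eexists _, _; apply: level_bounds_base.
elim: j => [|j [D' [H' b']]].
  by eexists _, _; apply: level_bounds_base; rewrite /cap ack_at1.
have w1 := ack_gt1 i j.
have [D [H b]] := IHi (ack i.+1 j.+1).-1; rewrite prednK ?(ltnW w1) // in b.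
by eexists _, _; apply: level_bounds_step w1 b b'.
Qed.

(** * Closed bounds for the coefficients *)

Lemma pow4_le_exp2 i : i.+1 ^ 4 <= 41 * 2 ^ i.
Proof.
(* The quotient is largest at 5, where it is 40.5; from there on the fourth power grows by a factor
   below 2. *)
elim: i => [//|i IH]; case: (ltnP i 5) => i5.
  by move: i i5 {IH}; do 5!case=> //.
rewrite [2 ^ _]expnS [41 * _]mulnCA; apply: (@leq_trans (2 * i.+1 ^ 4)); last by rewrite leq_mul2l.
rewrite !expnS !expn0; nia.
Qed.

Lemma mu4_le i : mu4 i <= 40 * 2 ^ i.
Proof.
(* With this correction the left side doubles exactly at each step. *)
suff : mu4 i + 8 * i + 32 <= 40 * 2 ^ i by lia.
elim: i => [//|i IH]; rewrite /= /mu3 expnS; lia.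
Qed.

Lemma nu5_le i : nu5 i <= 9 * i.+1 ^ 3.
Proof.
have n4 k : nu4 k <= 8 * k.+1 ^ 2.
  by elim: k => [//|k IH]; rewrite /= /mu3 !expnS !expn0 in IH *; nia.
elim: i => [//|i IH]; have := n4 i.+1; rewrite -[nu5 i.+1]/(1 + nu4 i.+1 + nu5 i).
move: (nu4 i.+1) => a.
rewrite !expnS !expn0 in IH *; nia.
Qed.

Lemma mu3_nu5_le i : mu3 i.+1 * nu5 i <= 4428 * 2 ^ i.
Proof.
(* Here 108 is 12 times 9, from [mu3 i.+1 <= 12 * i.+1] and [nu5_le]. *)
have -> : 4428 = 108 * 41 by []. rewrite -mulnA.
apply: (@leq_trans (108 * i.+1 ^ 4)); last by rewrite leq_mul2l pow4_le_exp2 orbT.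
have := nu5_le i; rewrite /mu3 (expnS _ 3); move: (nu5 i) (i.+1 ^ 3) => a b; nia.
Qed.

(** After division by [2 ^ i], each level adds at most 80 from [mu4] and 4428 from the marks, in
    total 4508. *)
Lemma mu5_le i : mu5 i <= 4508 * (i.+1 * 2 ^ i).
Proof.
elim: i => [//|i IH]; have := mu4_le i.+1; have := mu3_nu5_le i.
rewrite -[mu5 i.+1]/(2 * mu4 i.+1 + 2 * mu3 i.+1 * nu5 i + 2 * mu5 i) expnS -!mulnA.
move: (mu4 i.+1) (mu3 i.+1 * nu5 i) (2 ^ i) (mu5 i) IH => a b c d; nia.
Qed.

(** * Sequences without adjacent repeats *)

(** Testing only symbols of [s] makes the property decidable; for [k] at least 2 both letters of an
    alternation occur in [s]. *)
Definition altfreeb k (s : seq nat) :=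
  all (fun a => all (fun b => (a != b) ==> ~~ subseq (alt k a b) s) s) s.

Lemma altfreeP k s : 1 < k -> reflect (altfree k s) (altfreeb k s).
Proof.
move=> k1; apply: (iffP idP) => [h a b ab|h].
  apply/negP => sab; have [ain bin] := mem_alt a b k1.
  have /allP /(_ b (mem_subseq sab bin)) := allP h a (mem_subseq sab ain).
  by rewrite ab sab.
by apply/allP => a _; apply/allP => b _; apply/implyP; apply: h.
Qed.

Lemma not_altfreeb k s : ~~ altfreeb k s ->
  exists a b, a != b /\ subseq (alt k a b) s.
Proof.
case/allPn => a _ /allPn[b _]; rewrite negb_imply negbK => /andP[ab sab].
by exists a, b.
Qed.

Lemma shortest_bad_prefix k s : ~~ altfreeb k s -> altfreeb k [::] ->
  exists t x s', [/\ s = t ++ x :: s', altfreeb k t & ~~ altfreeb k (rcons t x)].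
Proof.
move=> + h0; elim/last_ind: s => [|s x IH]; first by rewrite h0.
case: (boolP (altfreeb k s)) => [hs hx|hs _]; first by exists s, x, [::]; rewrite cats1.
have [t [y [s' [-> ht hy]]]] := IH hs.
by exists t, y, (rcons s' x); rewrite -rcons_cons -rcons_cat.
Qed.

Lemma subseq_rcons_inv (s t : seq nat) e x :
  subseq (rcons s e) (rcons t x) -> subseq s t /\ (e != x -> subseq (rcons s e) t).
Proof.
rewrite -(subseq_rev (rcons s e)) -(subseq_rev s) -(subseq_rev (rcons s e) t) !rev_rcons.
rewrite /=; case: eqP => [_ //|_] h; split=> //.
by apply: subseq_trans h; apply: subseq_cons.
Qed.

Lemma size_undup_lt (s t : seq nat) b : {subset s <= t} -> b \in t -> b \notin s ->
  size (undup s) < size (undup t).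
Proof.
move=> st bt bs; rewrite -[_.+1]/(size (b :: undup s)); apply: uniq_leq_size.
  by rewrite /= mem_undup bs undup_uniq.
by move=> x; rewrite inE !mem_undup => /predU1P[->//|/st].
Qed.

Lemma size_undup_le (s t : seq nat) : {subset s <= t} -> size (undup s) <= size (undup t).
Proof.
move=> st; apply: uniq_leq_size (undup_uniq _) _ => x; rewrite !mem_undup; exact: st.
Qed.

(* Each maximal piece contains the first or the last occurrence of some symbol:
   otherwise the alternation that stopped it would extend on both sides. *)
Lemma greedy_cut k s : 2 < k -> altfree k.+2 s ->
  exists pss, [/\ flatten pss = s, forall p, p \in pss -> altfree k p &
    size pss <= 2 * size (undup s) + 1].
Proof.
move=> k2 af; have k1 := ltnW k2.
(* With [u] the part already cut off, the measure counts the symbols that start in [v] and those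
   that still occur in [v]. *)
suff main N u v : size v < N -> altfree k.+2 (u ++ v) ->
  exists pss, [/\ flatten pss = v, forall p, p \in pss -> altfree k p &
    size pss <= size (undup [seq x <- v | x \notin u]) + size (undup v) + 1].
  have [pss [fl ap sp]] := main (size s).+1 [::] s (ltnSn _) af.
  exists pss; split=> //; apply: leq_trans sp _.
  by rewrite (_ : filter _ s = s) ?mul2n ?addnn //; apply/all_filterP/allP.
elim: N u v => // N IH u v vN {}af.
case: (boolP (altfreeb k v)) => [/(altfreeP _ k1) av|nv].
  exists [:: v]; rewrite /= cats0 leq_addl; split=> // p.
  by rewrite inE => /eqP ->.
have [t [x [v' [ev at_ ntx]]]] := shortest_bad_prefix nv isT.
have [a [b [ab sab]]] := not_altfreeb ntx.
case: k k2 {k1} IH af at_ ntx sab nv => // k k2 IH af at_ ntx sab nv.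
(* [e] is the last letter of the alternation that stopped the piece, hence [x], and [e'] is the
   letter that would continue it. *)
pose e := if odd k then b else a; pose e' := if odd k then a else b.
have [st ex] : subseq (alt k a b) t /\ e = x.
  move: sab; rewrite altS_rcons -/e => /subseq_rcons_inv [st h]; split=> //.
  apply/eqP/negPn/negP => /h; rewrite /e -altS_rcons => sab.
  by move/(altfreeP _ (ltnW k2)): at_ => /(_ a b ab); rewrite sab.
have [ain bin] : (a \in t) * (b \in t).
  by split; apply: (mem_subseq st); rewrite mem_alt.
have e't : e' \in t by rewrite /e'; case: odd.
have e'x : e' != x by rewrite -ex /e' /e; case: odd; rewrite // eq_sym.
have tx_v : {subset x :: v' <= v} by move=> y yv; rewrite ev mem_cat yv orbT.
have t_v : {subset t <= v} by move=> y yt; rewrite ev mem_cat yt.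
have af2 : altfree k.+3 ((u ++ t) ++ x :: v') by rewrite -catA -ev.
have szv : size (x :: v') < N.
  move: vN; rewrite ev size_cat; case: (t) ain => //= y t' _; lia.
have [pss [fl ap sp]] := IH _ _ szv af2.
exists (t :: pss); rewrite /= fl -ev; split=> //.
  move=> p; rewrite inE => /predU1P[->|/ap //].
  by apply/(altfreeP _ (ltnW k2)).
have sub1 : {subset [seq y <- x :: v' | y \notin u ++ t] <= [seq y <- v | y \notin u]}.
  move=> y; rewrite !mem_filter mem_cat negb_or => /andP[/andP[-> _] /tx_v ->].
  by [].
(* Otherwise [b] before and [e'] after extend the alternation on both sides. In the first case [b]
   starts in [t], in the second [e'] ends there; either lowers the measure. *)
have dich : (b \notin u) || (e' \notin x :: v').
  rewrite -negb_and; apply/negP => /andP[bu]; rewrite inE (negbTE e'x) /= => e'v.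
  have ba : b != a by rewrite eq_sym.
  move/negP: (af b a ba); apply.
  have -> : alt k.+3 b a = [:: b] ++ alt k.+1 a b ++ [:: e'].
    rewrite -[LHS]/(b :: alt k.+2 a b) altS_rcons cats1 /= /e'.
    by case: (odd k).
  rewrite ev -cat_rcons; apply: cat_subseq; first by rewrite sub1seq.
  by apply: cat_subseq => //; rewrite sub1seq.
have h1 := size_undup_le sub1; have h2 := size_undup_le tx_v.
case/orP: dich => h.
  have : size (undup [seq y <- x :: v' | y \notin u ++ t]) <
         size (undup [seq y <- v | y \notin u]).
    apply: (size_undup_lt (b := b)) => //; first by rewrite mem_filter h t_v.
    by rewrite mem_filter mem_cat bin orbT.
  by move=> lt; apply: leq_ltn_trans sp _; rewrite ltn_add2r -addSn leq_add.
have : size (undup (x :: v')) < size (undup v).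
  by apply: (size_undup_lt (b := e')) => //; apply: t_v.
by move=> lt; apply: leq_ltn_trans sp _; rewrite ltn_add2r -addnS leq_add.
Qed.

(** * Numbered blocks and adjacent repeats *)

Fixpoint tag_blocks k (bs : seq (seq nat)) : seq occ :=
  if bs is b :: bs' then [seq (a, k) | a <- b] ++ tag_blocks k.+1 bs' else [::].

Lemma unzip1_cat (S T : seq occ) : unzip1 (S ++ T) = unzip1 S ++ unzip1 T.
Proof. exact: map_cat. Qed.

Lemma unzip1_tag k bs : unzip1 (tag_blocks k bs) = flatten bs.
Proof.
elim: bs k => //= b bs IH k; rewrite unzip1_cat IH /unzip1 -map_comp.
by rewrite map_id_in.
Qed.

Lemma mem_tag k bs x : x \in tag_blocks k bs -> k <= x.2 < k + size bs.
Proof.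
elim: bs k => //= b bs IH k; rewrite mem_cat => /orP[/mapP[a _ ->]|/IH] /=; lia.
Qed.

Lemma below_tag bs : below (size bs) (tag_blocks 0 bs).
Proof. by apply/allP => x /mem_tag. Qed.

Lemma sorted_tag k bs : sorted leq (unzip2 (tag_blocks k bs)).
Proof.
elim: bs k => //= b bs IH k; rewrite /unzip2 map_cat -map_comp.
rewrite (sorted_pairwise leq_trans) pairwise_cat -!(sorted_pairwise leq_trans) IH andbT.
apply/andP; split.
  by apply/allrelP => p q /mapP[a _ ->] /mapP[x /mem_tag /andP[/ltnW h _] ->].
by elim: b => //= a [|a' b] //= ->; rewrite leqnn.
Qed.

Lemma uniq_tag k bs : all uniq bs -> uniq (tag_blocks k bs).
Proof.
elim: bs k => //= b bs IH k /andP[ub /IH {}IH]; rewrite cat_uniq IH andbT.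
rewrite map_inj_uniq ?ub /=; last by move=> a c [].
apply/hasPn => x /mem_tag h; apply/mapP => [[a _ e]]; move: h; rewrite e /=; lia.
Qed.

Lemma wf_tag bs : all uniq bs -> wf (tag_blocks 0 bs).
Proof. by move=> u; split; [exact: uniq_tag|exact: sorted_tag]. Qed.

Lemma tag_fiber k bs r :
  unzip1 [seq x <- tag_blocks k bs | x.2 == k + r] = nth [::] bs r.
Proof.
elim: bs k r => [|b bs IH] k r /=; first by rewrite nth_nil.
rewrite filter_cat unzip1_cat filter_map.
case: r => [|r].
  rewrite addn0 [X in _ ++ unzip1 X](_ : _ = [::]) ?cats0.
    rewrite (_ : filter _ b = b) /unzip1 -?map_comp ?map_id_in //.
    by apply/all_filterP/allP => a _ /=; rewrite eqxx.
  apply/eqP; rewrite -(negbK (_ == _)) -has_filter; apply/hasPn => [[c o]] /mem_tag /andP[h _].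
  by rewrite neq_ltn /= h orbT.
rewrite addnS -addSn IH [filter _ b](_ : _ = [::]) //.
apply/eqP; rewrite -(negbK (_ == _)) -has_filter; apply/hasPn => a _ /=.
by apply/eqP; lia.
Qed.

Definition sparse (s : seq nat) := sorted (fun x y => x != y) s.

Lemma altfree3_sparse_uniq s : altfree 3 s -> sparse s -> uniq s.
Proof.
elim: s => //= x s IH af sp; have {}IH : uniq s.
  by apply: IH; [apply: altfree_subseq af; apply: subseq_cons|exact: path_sorted sp].
rewrite IH andbT; apply/negP => xs; case: s xs sp af {IH} => //= y s.
rewrite inE => xs /andP[xy _] /(_ x y xy); rewrite /= !eqxx.
by case/predU1P: xs => [e|xs]; [rewrite e eqxx in xy|rewrite sub1seq xs].
Qed.

Lemma sparse_pieces pss p : sparse (flatten pss) -> p \in pss -> sparse p.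
Proof.
elim: pss => //= q pss IH /cat_sorted2 [sq sp]; rewrite inE => /predU1P[->//|].
exact: IH.
Qed.

Fixpoint squeeze (s : seq nat) : seq nat :=
  if s is x :: s' then
    if s' is y :: _ then (if x == y then squeeze s' else x :: squeeze s') else [:: x]
  else [::].

Lemma squeeze_subseq s : subseq (squeeze s) s.
Proof.
elim: s => // x [|y s] IH; first exact: subseq_refl.
rewrite [squeeze _]/= -/(squeeze (y :: s)); case: eqP => _; last by rewrite /= eqxx.
exact: subseq_trans IH (subseq_cons _ _).
Qed.

Lemma sparse_squeeze s : sparse (squeeze s).
Proof.
have hd x s' : exists t, squeeze (x :: s') = x :: t.
  elim: s' x => [|y s' IH] x; first by exists [::].
  rewrite [squeeze _]/= -/(squeeze (y :: s')).
  by case: eqP => [->|_]; [exact: IH|exists (squeeze (y :: s'))].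
rewrite /sparse; elim: s => // x [|y s] IH //.
rewrite [squeeze _]/= -/(squeeze (y :: s)); case: eqP => // /eqP xy.
by have [t e] := hd y s; rewrite e /= in IH *; rewrite xy.
Qed.

(** Equal neighbours lie in different blocks, so each deletion moves to a larger block number. The
    induction adds the block number of the first entry. *)
Lemma size_squeeze m T : wf T -> below m T -> size T <= m + size (squeeze (unzip1 T)).
Proof.
case: T => // x T [uT sT] bT.
suff : size (x :: T) + x.2 <= m + size (squeeze (unzip1 (x :: T))) by lia.
elim: T x uT sT bT => [|y T IH] x; first by move=> _ _ /=; rewrite andbT; lia.
move=> /= /andP[xn uT] /andP[xy sT] /andP[xm bT].
have {IH} := IH y uT sT bT; rewrite /=.
rewrite -/(squeeze (y.1 :: unzip1 T)); case: eqP => [e|_] /= h; last by lia.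
suff : x.2 != y.2 by lia.
move: xn; rewrite inE negb_or => /andP[+ _]; apply: contra => /eqP e2.
by case: (x) (y) e e2 => [? ?] [? ?] /= -> ->.
Qed.

(** The greedy pieces have order 1, and an order 1 sequence without adjacent repeats has distinct
    entries. *)
Lemma sparse_blocks s : sparse s -> altfree 5 s ->
  exists bs, [/\ flatten bs = s, all uniq bs & size bs <= 2 * size (undup s) + 1].
Proof.
move=> sp af; have [bs [fl ab sb]] := @greedy_cut 3 s isT af.
exists bs; split=> //; apply/allP => p pb; apply: altfree3_sparse_uniq; first exact: ab.
by apply: sparse_pieces pb; rewrite fl.
Qed.

Lemma nsym_tag bs : nsym (tag_blocks 0 bs) = size (undup (flatten bs)).
Proof. by rewrite /nsym unzip1_tag. Qed.

Lemma size_tag bs : size (tag_blocks 0 bs) = size (flatten bs).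
Proof. by rewrite -(unzip1_tag 0) size_map. Qed.

Lemma size_bound_flatten k cap mu ka bs m : size_bound k cap mu ka ->
  size bs <= m <= cap -> all uniq bs -> altfree k (flatten bs) ->
  size (flatten bs) <= mu * size (undup (flatten bs)) + ka * m.
Proof.
move=> hb /andP[sb mc] ub af; rewrite -size_tag -nsym_tag; apply: hb => //.
- exact: wf_tag.
- by apply/allP => x /(allP (below_tag bs)) /leq_trans; apply.
by rewrite unzip1_tag.
Qed.

(** The number of blocks enters with coefficient 1 only: adjacent repeats are removed first, and the
    result is cut again into a number of blocks linear in its symbols. *)
Lemma order3_flatten i j bs : size_bound 5 (cap i j) (mu3 i) (mu3 i * j) ->
  all uniq bs -> altfree 5 (flatten bs) ->
  2 * size (undup (flatten bs)) + 1 <= cap i j ->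
  size (flatten bs) <=
    size bs + mu3 i * (1 + 3 * j) * size (undup (flatten bs)).
Proof.
move=> hb ub af mc; set s := flatten bs in af mc *.
have ss := squeeze_subseq s.
have s_le : size s <= size bs + size (squeeze s).
  by have := size_squeeze (wf_tag ub) (below_tag bs); rewrite unzip1_tag size_tag.
have [cs [fc uc sc]] := sparse_blocks (sparse_squeeze s) (altfree_subseq ss af).
have us := size_undup_le (mem_subseq ss).
have hm : size cs <= 2 * size (undup s) + 1 <= cap i j.
  by rewrite mc andbT; apply: leq_trans sc _; rewrite leq_add2r leq_mul2l us.
have := size_bound_flatten hb hm uc; rewrite fc => /(_ (altfree_subseq ss af)) h.
case: (posnP (size (undup s))) => [s0|s0].
  have -> : s = [::] by apply/undup_nil/size0nil.
  by [].
apply: leq_trans s_le _; rewrite leq_add2l; apply: leq_trans h _.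
apply: (@leq_trans (mu3 i * size (undup s) + mu3 i * j * (3 * size (undup s)))).
  by apply: leq_add; rewrite leq_mul2l ?us ?orbT //; apply/orP; right; lia.
by apply: eq_leq; lia.
Qed.

Lemma flatten_filter (Q : pred nat) bs :
  flatten (map (filter Q) bs) = filter Q (flatten bs).
Proof. by rewrite filter_flatten. Qed.

(** [K] bounds the number of greedy pieces and [A] the size of the sequence contracted to them; the
    last factor bounds the symbols that are first, last or marked in a piece, counted over all
    pieces. *)
Lemma sparse_bound i j D H n s : level_bounds i j D H -> sparse s -> altfree 7 s ->
  size (undup s) <= n -> 2 * n + 1 <= cap i j ->
  forall K A, K = 2 * n + 1 -> A = mu5 i * n + mu5 i * j ^ 3 * K ->
  size s <= 6 * A + 2 * K +
    mu3 i * (1 + 3 * j) * (2 * n + 2 * (nu5 i * n + nu5 i * j ^ 3 * K)).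
Proof.
move=> [[_ _ cov] _ [mD mH] [S5 _ S7]] sp af sn nc K A EK EA; rewrite -EK in nc.
have [pss [fl ap sK]] := greedy_cut (isT : 2 < 5) af.
have {}sK : size pss <= K by apply: leq_trans sK _; rewrite EK leq_add2r leq_mul2l.
pose S := tag_blocks 0 pss; have uS : unzip1 S = s by rewrite unzip1_tag.
have soS : sorted leq (unzip2 S) by apply: sorted_tag.
have bS : below K S by apply/allP => x /(allP (below_tag pss)) /leq_trans; apply.
have afS : altfree 7 (unzip1 S) by rewrite uS.
have nS : nsym S <= n by rewrite /nsym uS.
(* A piece may repeat symbols, so [S] need not be [wf]; contraction with [L = 1] turns each piece
   into a block. *)
pose C := contract 1 S; have wC : wf C by apply: wf_contract.
have bC : below K C by apply/allP => [[a r]] /mem_contract[p /(allP bS) /=]; rewrite divn1 => ? <-.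
have afC := altfree_subseq (contract_unzip1 1 S) afS.
have nC : nsym C <= n.
  exact: leq_trans (nsym_contract 1 S) nS.
have sC : size C <= A.
  by apply: leq_trans (S7 _ _ nc wC bC afC) _; rewrite EA leq_add2r leq_mul2l nC orbT.
have sM E : mark_bound E 7 (cap i j) (nu5 i) (nu5 i * j ^ 3) ->
    size (contract 1 [seq x <- S | marked_in E 1 S x]) <= nu5 i * n + nu5 i * j ^ 3 * K.
  move=> hE; apply: leq_trans (size_contract_marked E 1 S) _.
  by apply: leq_trans (hE _ _ nc wC bC afC) _; rewrite leq_add2r leq_mul2l nC orbT.
pose un x := [&& ~~ first_in true 1 S x, ~~ first_in false 1 S x,
  ~~ marked_in D 1 S x & ~~ marked_in H 1 S x].
pose U := [seq x <- S | un x]; pose V := [seq x <- S | ~~ un x].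
have cU : size (contract 1 U) <= A.
  by apply: leq_trans (size_contract_le _ (mem_subseq (filter_subseq _ _))) sC.
have cV : size (contract 1 V) <= 2 * n + 2 * (nu5 i * n + nu5 i * j ^ 3 * K).
  have f d : size (contract 1 [seq x <- S | first_in d 1 S x]) <= n.
    exact: leq_trans (size_contract_first d 1 S) nS.
  pose X c := contract 1 [seq x <- S | c x].
  have : size (contract 1 V) <= size (X (first_in true 1 S) ++ X (first_in false 1 S) ++
      X (marked_in D 1 S) ++ X (marked_in H 1 S)).
    apply: uniq_leq_size (undup_uniq _) _ => [[a r]] /mem_contract[p].
    rewrite mem_filter => /andP[h pS] <-; rewrite !mem_cat.
    have inX (c : pred occ) : c (a, p) -> (a, p %/ 1) \in X c.
      by move=> cp; apply: contract_mem; rewrite mem_filter cp.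
    move: h; rewrite /un !negb_and !negbK => /or4P[] /inX ->; by rewrite ?orbT.
  move=> h; apply: leq_trans h _; rewrite !size_cat.
  apply: leq_trans (leq_add (f true) (leq_add (f false) (leq_add (sM D mD) (sM H mH)))) _.
  lia.
have sS : size s = size U + size V.
  by rewrite -uS size_map !size_filter (count_predC un).
rewrite sS (@size_parts 1 K U) ?(@size_parts 1 K V); last 2 first.
- by apply: below_sub bS; apply/mem_subseq/filter_subseq.
- by apply: below_sub bS; apply/mem_subseq/filter_subseq.
rewrite -big_split /=; set g := mu3 i * _.
(* The blocks of a piece, at most [2 * nsym + 1], are charged once for [U] and once for [V], which
   gives the 4 and the final 2. *)
apply: (@leq_trans (\sum_(r < K) (4 * nsym (part 1 r S) + 2 * nsym (part 1 r U) +
    g * nsym (part 1 r V) + 2))); last first.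
  rewrite 3!big_split /= -!big_distrr /= sum_nat_const card_ord.
  have h1 := leq_trans (sum_nsym_part 1 K S) sC.
  have h2 := leq_trans (sum_nsym_part 1 K U) cU.
  have h3 : g * (\sum_(r < K) nsym (part 1 r V)) <=
    g * (2 * n + 2 * (nu5 i * n + nu5 i * j ^ 3 * K)).
    by rewrite leq_mul2l (leq_trans (sum_nsym_part 1 K V) cV) orbT.
  rewrite addnAC [K * 2]mulnC; apply: leq_add h3; rewrite leq_add2r (mulnDl 4 2 A).
  by rewrite leq_add // leq_mul2l.
apply: leq_sum => r _.
have piece : unzip1 (part 1 r S) = nth [::] pss r.
  rewrite -(tag_fiber 0 pss r) /unzip1 /part -map_comp; congr map.
  by apply: eq_filter => x; rewrite divn1.
have spP : sparse (unzip1 (part 1 r S)).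
  rewrite piece; case: (ltnP r (size pss)) => h; last by rewrite nth_default.
  by apply: (@sparse_pieces pss); rewrite ?fl // mem_nth.
have afP : altfree 5 (unzip1 (part 1 r S)).
  rewrite piece; case: (ltnP r (size pss)) => h; first by apply/ap/mem_nth.
  by rewrite nth_default // => a b _.
have [bs [fb ub sb]] := sparse_blocks spP afP.
(* Within a piece [P] depends on the symbol only, so restricting to [P] filters every block. *)
have restr (P : pred occ) : unzip1 (part 1 r [seq x <- S | P x]) =
    flatten (map (filter (fun a => P (a, r : nat))) bs).
  rewrite flatten_filter fb /unzip1 /part filter_map -!map_comp -!filter_predI.
  rewrite filter_map -map_comp -filter_predI; congr map; apply: eq_filter => [[a p]] /=.
  by rewrite ?divn1; case: eqP => [->|_]; rewrite ?andbT ?andbF.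
have ubf Q : all uniq (map (filter Q) bs).
  by rewrite all_map; apply: sub_all ub => b; apply: filter_uniq.
have szP (P : pred occ) : size (part 1 r [seq x <- S | P x]) =
    size (unzip1 (part 1 r [seq x <- S | P x])) by rewrite [RHS]size_map.
have subP_ (P : pred occ) : subseq (unzip1 (part 1 r [seq x <- S | P x])) (unzip1 (part 1 r S)).
  exact: unzip1_subseq (part_subseq 1 r (filter_subseq _ _)).
have sU : size (part 1 r U) <= 2 * nsym (part 1 r U) + 1 * size bs.
  rewrite szP /nsym restr; apply: (size_bound_flatten (@size_bound4 (size bs))) => //.
    by rewrite size_map leqnn.
  by rewrite -restr; apply: altfree_unmarked.
have sV : size (part 1 r V) <= size bs + g * nsym (part 1 r V).
  rewrite szP /nsym restr.
  rewrite -[size bs](size_map (filter (fun a => ~~ un (a, r : nat)))).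
  apply: (order3_flatten S5) => //; rewrite -(restr (fun x => ~~ un x)); first exact: altfree_subseq (subP_ _) afP.
  apply: leq_trans nc; rewrite [X in _ <= X]EK leq_add2r leq_mul2l /=; apply: leq_trans sn.
  apply: size_undup_le => a /(mem_subseq (subP_ _)) /mapP[[c o] /mem_part[p pS _] ->].
  by rewrite -uS; apply: (map_f fst pS).
have sb' : size bs <= 2 * nsym (part 1 r S) + 1 by [].
lia.
Qed.

(** * The two bounds *)

Lemma altfree7P s : ~ has_alt7 s <-> altfree 7 s.
Proof.
split=> [h a b ab|h [a [b [ab sab]]]]; last by have := h a b ab; rewrite /= sab.
by apply/negP => sab; apply: h; exists a, b.
Qed.

Lemma sparseP s : no_adjacent_repeat s <-> sparse s.
Proof. by split=> [h|/sortedP h]; [apply/(sortedP 0)|exact: h]. Qed.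

Lemma coef_bounds : exists c, forall i,
  mu5 i <= c * (i.+1 * 2 ^ i) /\ mu3 i * nu5 i <= c * 2 ^ i.
Proof.
exists 4508 => i; split; first exact: mu5_le.
apply: (@leq_trans (mu3 i.+1 * nu5 i)); first by rewrite leq_mul2r /mu3; lia.
by apply: leq_trans (mu3_nu5_le i) _; rewrite leq_mul2r orbC.
Qed.

Lemma sparse_size_le : exists C, forall n s, 1 <= n -> sparse s -> altfree 7 s ->
  size (undup s) <= n -> size s <= C * (n * alpha n * 2 ^ alpha n).
Proof.
have [c hc] := coef_bounds; exists (2644 * c + 6) => n s n0 sp af sn.
have [i ai [ni _]] := alpha2_spec n n; rewrite /alpha ai.
have c1 : maxn (ceil_div n n) 3 = 3.
  rewrite /ceil_div; apply/maxn_idPr; rewrite -ltnS ltn_divLR //; lia.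
rewrite c1 in ni.
(* Index 3 is the one in [alpha n]; cubing in [cap] leaves room for [2 * n + 1] pieces. *)
have [D [H b]] := level_bounds_exist i.+1 2.
have a8 : 8 <= ack i.+1 3 by apply: (@ack_ge_exp2 i 3).
have hcap : 2 * n + 1 <= cap i.+1 3.
  rewrite /cap; move: (ack i.+1 3) ni a8 => a; rewrite !expnS expn0; nia.
have := sparse_bound b sp af sn hcap erefl erefl.
have [hm hn] := hc i.+1; have [_ _ _ _ n5] := coef_ge8 i.+1.
have e0 : 0 < 2 ^ i.+1 by rewrite expn_gt0.
move: (mu5 i.+1) (mu3 i.+1) (nu5 i.+1) (2 ^ i.+1) hm hn n5 e0 => m a v e hm hn n5 e0 h.
apply: leq_trans h _.
have hE : n <= n * (i.+1 * e) by rewrite leq_pmulr // muln_gt0.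
have hmE : m * n <= 2 * c * (n * (i.+1 * e)).
  apply: (@leq_trans (c * (i.+2 * e) * n)); first by rewrite leq_mul2r hm orbT.
  have : i.+2 * (c * e * n) <= 2 * i.+1 * (c * e * n) by rewrite leq_mul2r; lia.
  lia.
have hvE : a * v * n <= c * (n * (i.+1 * e)).
  apply: (@leq_trans (c * e * n)); first by rewrite leq_mul2r hn orbT.
  have : 1 * (c * e * n) <= i.+1 * (c * e * n) by rewrite leq_mul2r orbT.
  lia.
have haE : a * n <= a * v * n by rewrite leq_mul2r leq_pmulr ?orbT // (leq_trans _ n5).
have nn : m <= m * n /\ a * v <= a * v * n by rewrite !leq_pmulr.
rewrite -(mulnA n); move: (n * (i.+1 * e)) hE hmE hvE => F hE hmE hvE.
rewrite (_ : 3 ^ 3 = 27) // (_ : 1 + 3 * 3 = 10) //.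
case: nn => nn1 nn2.
(* Obtained with [2 * n + 1 <= 3 * n]: 492 is 6 times 55 + 27, and 1660 is 20 + 20 + 1080 + 540. *)
apply: (@leq_trans (492 * (m * n) + 6 * n + 1660 * (a * v * n))); first lia.
lia.
Qed.

(** One level above [alpha2 n m] costs a constant factor, but lowers the index from [j] to about
    [log j], so that the additive term [(log j)^3 * m] is [O(j * m)], hence [O(n)]. *)
Lemma blocks_size_le : exists C, forall n m s, 1 <= m <= n -> DS5blocks n m s ->
  size s <= C * (n * alpha2 n m * 2 ^ alpha2 n m).
Proof.
have [c hc] := coef_bounds.
exists (c * 3000) => n m s /andP[m0 mn] [sn [/altfree7P af [bs [sb [ub fb]]]]].
have [i ai [mi _]] := alpha2_spec n m; rewrite ai; set j := maxn _ 3 in mi.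
have jm : j * m <= 3 * n.
  rewrite /j maxnMl geq_max /ceil_div; apply/andP; split.
    by apply: leq_trans (leq_trunc_div _ _) _; lia.
  by rewrite leq_mul2l mn orbT.
pose l := (up_log 2 j).+1.
have [D [H [_ _ _ [_ _ hb]]]] := level_bounds_exist i.+2 l.
have jl : j <= ack i.+2 l.
  apply: leq_trans (@ack_ge_exp2 i.+1 l isT); apply: leq_trans (@up_logP 2 j isT) _.
  by rewrite leq_exp2l.
have mcap : m <= cap i.+2 l.+1.
  rewrite /cap /l ack_succ -/l; set w := ack i.+2 l in jl *.
  have w1 : 0 < w by apply/ltnW/ack_gt1.
  have h : m <= w * ack i.+1 w.
    apply: leq_trans mi _; apply: leq_trans (ack_monotone i jl) _; exact: leq_pmull.
  apply: leq_trans h _; rewrite -[X in X <= _]expn1; apply: leq_pexp2l => //.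
  by rewrite muln_gt0 w1 /= -(prednK w1) ltnW // ack_gt1.
have hs : size bs <= m <= cap i.+2 l.+1 by rewrite sb mcap.
have := size_bound_flatten hb hs ub; rewrite fb => /(_ af) h.
apply: leq_trans h _.
(* The factor 164 is 41 times 4, since [2 ^ l] is less than [4 * j]. *)
have l3 : l.+1 ^ 3 <= 164 * j.
  apply: (@leq_trans (l.+1 ^ 4)); first by rewrite leq_pexp2l.
  apply: leq_trans (pow4_le_exp2 l) _; rewrite /l expnS.
  have : 2 ^ (up_log 2 j).-1 < j.
    by apply: up_log_gtn => //; rewrite /j leq_max orbT.
  have : 0 < up_log 2 j by rewrite up_log_gt0 //= /j leq_max orbT.
  by case: (up_log 2 j) => // k _ /=; rewrite expnS; lia.
have [hm _] := hc i.+2.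
(* From [j * m <= 3 * n], and 493 is 1 + 3 * 164. *)
apply: (@leq_trans (mu5 i.+2 * (493 * n))).
  have : l.+1 ^ 3 * m <= 164 * j * m by rewrite leq_mul2r l3 orbT.
  move=> h; have : l.+1 ^ 3 * m <= 492 * n by lia.
  move=> h'; have := leq_mul (leqnn (mu5 i.+2)) h'.
  have := leq_mul (leqnn (mu5 i.+2)) sn; lia.
apply: (@leq_trans (c * (i.+3 * 2 ^ i.+2) * (493 * n))).
  by rewrite leq_mul2r hm orbT.
rewrite [2 ^ i.+2]expnS; move: (2 ^ i.+1) => e.
have : i.+3 * (c * e * n) <= 3 * i.+1 * (c * e * n) by rewrite leq_mul2r; lia.
lia.
Qed.

Theorem mainTheorem11 :
  (exists C : nat, forall (n : nat) (s : seq nat), 1 <= n -> DS5 n s ->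
      size s <= C * (n * alpha n * 2 ^ alpha n))
  /\
  (exists C : nat, forall (n m : nat) (s : seq nat), 1 <= n -> 1 <= m ->
      DS5blocks n m s ->
      size s <= m + C * (n * alpha2 n m * 2 ^ alpha2 n m)).
Proof.
have [C1 h1] := sparse_size_le; have [C2 h2] := blocks_size_le.
split.
  by exists C1 => n s n0 [sn [/sparseP sp /altfree7P af]]; apply: h1.
exists (C1 + C2) => n m s n0 m0 ds; case: (leqP m n) => mn.
  apply: leq_trans (h2 n m s _ ds) _; first by rewrite m0.
  by apply: leq_trans (leq_addl _ _); rewrite leq_mul2r leq_addl orbT.
(* For [m > n], deleting adjacent repeats loses at most [m] entries and reduces to the first
   bound. *)
case: ds => [sn [/altfree7P af [bs [sb [ub fb]]]]].
have ss := squeeze_subseq s.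
have szs : size s <= m + size (squeeze s).
  rewrite -fb -size_tag -(unzip1_tag 0); apply: size_squeeze; first exact: wf_tag.
  by apply/allP => x /(allP (below_tag bs)) /leq_trans; apply.
apply: leq_trans szs _; rewrite leq_add2l.
have us := leq_trans (size_undup_le (mem_subseq ss)) sn.
apply: leq_trans (h1 n _ n0 (sparse_squeeze s) (altfree_subseq ss af) us) _.
(* As [n < m], both use index 3, and reaching [m] takes at least the level that reaches [n]. *)
have le : alpha n <= alpha2 n m.
  have [i ai [_ min]] := alpha2_spec n n; have [k -> [mk _]] := alpha2_spec n m.
  rewrite /alpha ai ltnS.
  have cd p : n <= p -> maxn (ceil_div n p) 3 = 3.
    move=> np; have p0 := leq_trans n0 np.
    rewrite /ceil_div; apply/maxn_idPr; rewrite -ltnS ltn_divLR //; lia.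
  rewrite cd // in min; rewrite cd ?(ltnW mn) // in mk.
  (* Minimality is available for levels up to [n]; above, level [n] itself already reaches [n]. *)
  case: (leqP k n) => kn; last first.
    apply: leq_trans (ltnW kn); apply: min => //; exact/ltnW/ack_ge_level.
  by apply: min => //; apply: leq_trans (ltnW mn) mk.
apply: leq_mul; first exact: leq_addr.
by apply: leq_mul; [rewrite leq_mul2l le orbT|rewrite leq_exp2l].
Qed.
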